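(* Let $\mathfrak M$ be a Hilbert space. (a) Let $\Omega\in\mathcal{RS}(\mathfrak M)$. Then, for $\lambda\in\mathbb C\setminus\mathbb R_+$, $$\mathcal Q(\lambda)=-I+2\Big(I_{\mathfrak M}-\Omega\big(\tfrac{1+\lambda}{1-\lambda}\big)\Big)^{-1}=\Big\{\Big\{\big(I_{\mathfrak M}-\Omega\big(\tfrac{1+\lambda}{1-\lambda}\big)\big)h,\ \big(I_{\mathfrak M}+\Omega\big(\tfrac{1+\lambda}{1-\lambda}\big)\big)h\Big\}:\ h\in\mathfrak M\Big\}\qquad (\ast)$$ is a Stieltjes family in $\mathfrak M$, and $$\mathcal R(\lambda)=I-2\Big(I_{\mathfrak M}+\Omega\big(\tfrac{1+\lambda}{1-\lambda}\big)\Big)^{-1}=\Big\{\Big\{\big(I_{\mathfrak M}+\Omega\big(\tfrac{1+\lambda}{1-\lambda}\big)\big)h,\ \big(\Omega\big(\tfrac{1+\lambda}{1-\lambda}\big)-I_{\mathfrak M}\big)h\Big\}:\ h\in\mathfrak M\Big\}\qquad (\ast\ast)$$ is an inverse Stieltjes family in $\mathfrak M$. (b) Conversely, if $\mathcal Q(\lambda)$ is a Stieltjes family (respectively, $\mathcal R(\lambda)$ is an inverse Stieltjes family) in $\mathfrak M$, then there exists a function $\Omega\in\mathcal{RS}(\mathfrak M)$ such that $(\ast)$ (respectively, $(\ast\ast)$) holds. (c) Furthermore, the functions $\mathcal Q$ in $(\ast)$ and $\mathcal R$ in $(\ast\ast)$ are connected by $\mathcal R=-\mathcal Q^{-1}$,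 and thus $\mathcal Q\in\widetilde{\mathcal S}(\mathfrak M)$ if and only if $-\mathcal Q^{-1}\in\widetilde{\mathcal S}^{(-1)}(\mathfrak M)$.
   Context: All Hilbert spaces are complex and separable; $\mathbb R_+=[0,+\infty)$, and $\mathbb C_\pm$ are the open upper/lower half-planes. $\mathbf B(\mathfrak M)$ is the algebra of bounded everywhere defined operators on $\mathfrak M$. A linear relation in $\mathfrak M$ is a linear subspace $H$ of $\mathfrak M\times\mathfrak M$, with elements $\{f,f'\}$; operators are identified with their graphs. $H^{-1}=\{\{f',f\}:\{f,f'\}\in H\}$, $cH=\{\{f,cf'\}\}$, $H+cI=\{\{f,f'+cf\}\}$. The adjoint is $H^*=\{\{k,k'\}:(h',k)=(h,k')\ \forall\{h,h'\}\in H\}$. $H$ is nonnegative ($H\ge0$) if $(f',f)\ge 0$ for all $\{f,f'\}\in H$, and $H\le0$ if $-H\ge0$. $H$ is dissipative (accumulative) if $\operatorname{Im}(f',f)\ge0$ ($\le0$) for all $\{f,f'\}\in H$; maximal means having no proper extension with the same property. A family of linear relations $\mathcal M(\lambda)$, $\lambda\in\mathbb C\setminus\mathbb R$, in $\mathfrak M$ is a Nevanlinna family if: (i) $\mathcal M(\lambda)$ is maximal dissipative for every $\lambda\in\mathbb C_+$ (resp. maximal accumulative for every $\lambda\in\mathbb C_-$); (ii) $\mathcal M(\lambda)^*=\mathcal M(\bar\lambda)$ for $\lambda\in\mathbb C\setminus\mathbb R$; (iii) for some (hence all) $\mu\in\mathbb C_+$ ($\mathbb C_-$) the operator family $(\mathcal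 M(\lambda)+\mu)^{-1}\in\mathbf B(\mathfrak M)$ is holomorphic for all $\lambda\in\mathbb C_+$ ($\mathbb C_-$). A family $\mathcal M(\lambda)$, $\lambda\in\mathbb C\setminus\mathbb R_+$, is a Stieltjes family (respectively inverse Stieltjes family) if it is a Nevanlinna family and, moreover, (i) $\mathcal M(x)\ge0$ for all $x<0$ (respectively $\mathcal M(x)\le0$ for all $x<0$), (ii) for some (hence all) $\mu\in\mathbb C_+$ ($\mathbb C_-$) the operator family $(\mathcal M(\lambda)+\mu)^{-1}\in\mathbf B(\mathfrak M)$, $\lambda\in\mathbb C_+$ ($\mathbb C_-$), admits an analytic continuation to the semi-axis $(-\infty,0)$. (The values at $x<0$ are then selfadjoint relations.) The classes are denoted $\widetilde{\mathcal S}(\mathfrak M)$ and $\widetilde{\mathcal S}^{(-1)}(\mathfrak M)$, respectively. The class $\mathcal{RS}(\mathfrak M)$ consists of all $\mathbf B(\mathfrak M)$-valued Nevanlinna functions $\Omega$ (i.e. $\Omega(z)^*=\Omega(\bar z)$ and $\operatorname{Im}\Omega(z)/\operatorname{Im}z\ge0$ for $z\notin\mathbb R$) that are holomorphic on $\mathbb C\setminus\{(-\infty,-1]\cup[1,+\infty)\}$ and satisfy $-I\le\Omega(x)\le I$ for $x\in(-1,1)$. Inverses in the claim are understood in the sense of linear relations. *)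

(* Defs.v *)
From HB Require Import structures.
From mathcomp Require Import all_boot all_order all_algebra sesquilinear.
From mathcomp Require Import complex.
From mathcomp Require Import all_classical all_reals all_analysis.
Import Order.TTheory GRing.Theory Num.Theory numFieldNormedType.Exports.

Set Implicit Arguments.
Unset Strict Implicit.
Unset Printing Implicit Defensive.

Local Open Scope classical_set_scope.
Local Open Scope ring_scope.

Section Relations.
Variables (R : realType) (M : completeNormedModType R[i]).
Variable dot : {dot M for (@Num.conj R[i])}.

(* [completeNormedModType] supplies completeness.  [dot] is linear in its first
   argument and conjugate-linear in the second one. *)
Definition separable_hilbert : Prop :=
  (forall f : M, `|f| ^+ 2 = dot f f) /\
  exists2 D : set M, countable D & dense D.

Definition bounded_op (T : M -> M) : Prop :=
  linear T /\ exists c : R[i], forall f, `|T f| <= c * `|f|.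

(* Complex differentiability at [z0] for the operator norm. *)
Definition holomorphic_at (F : R[i] -> M -> M) (z0 : R[i]) : Prop :=
  exists2 D : M -> M, bounded_op D &
    forall e : R[i], 0 < e -> \forall z \near (z0 : R[i]^o)^',
      forall f, `|(z - z0)^-1 *: (F z f - F z0 f) - D f| <= e * `|f|.

(* Meant for open [U]. *)
Definition holomorphic_on (U : set R[i]) (F : R[i] -> M -> M) : Prop :=
  forall z, U z -> bounded_op (F z) /\ holomorphic_at F z.

Definition linear_relation (H : set (M * M)) : Prop :=
  H 0 /\ forall a u v, H u -> H v -> H (a *: u + v).

Definition graph_rel (T : M -> M) : set (M * M) := [set p | p.2 = T p.1].

Definition inv_rel (H : set (M * M)) : set (M * M) := [set p | H (p.2, p.1)].

Definition scale_rel (c : R[i]) (H : set (M * M)) : set (M * M) :=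
  [set (p.1, c *: p.2) | p in H].

Definition shift_rel (H : set (M * M)) (c : R[i]) : set (M * M) :=
  [set (p.1, p.2 + c *: p.1) | p in H].

Definition adjoint_rel (H : set (M * M)) : set (M * M) :=
  [set k | forall h, H h -> dot h.2 k.1 = dot h.1 k.2].

(* In the order of [R[i]], [0 <= z] says that [z] is real and nonnegative. *)
Definition nonneg_rel (H : set (M * M)) : Prop :=
  linear_relation H /\ forall p, H p -> 0 <= dot p.2 p.1.

Definition nonpos_rel (H : set (M * M)) : Prop := nonneg_rel (scale_rel (-1) H).

Definition dissipative (H : set (M * M)) : Prop :=
  linear_relation H /\ forall p, H p -> 0 <= 'Im (dot p.2 p.1).

Definition accumulative (H : set (M * M)) : Prop :=
  linear_relation H /\ forall p, H p -> 'Im (dot p.2 p.1) <= 0.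

Definition maximal_rel (P : set (M * M) -> Prop) (H : set (M * M)) : Prop :=
  P H /\ forall H', P H' -> H `<=` H' -> H' = H.

Definition upper_half : set R[i] := [set z | 0 < 'Im z].
Definition lower_half : set R[i] := [set z | 'Im z < 0].
Definition nonreal : set R[i] := [set z | 'Im z != 0].
Definition negative_axis : set R[i] := [set z | z < 0].

(* C \ R_+ : [0 <= z] holds exactly on the closed real half-line. *)
Definition slit_plane : set R[i] := [set z | ~~ (0 <= z)].

(* C \ ((-oo, -1] `|` [1, +oo)) : both comparisons force [z] to be real. *)
Definition RS_domain : set R[i] := [set z | ~~ (z <= -1) && ~~ (1 <= z)].

(* On [A], the resolvents (Q(z) + mu)^-1 lie in B(M) and are the values of a
   function that is holomorphic on an open set containing [A]. *)
Definition holomorphic_resolvent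
    (Q : R[i] -> set (M * M)) (mu : R[i]) (A : set R[i]) : Prop :=
  exists (U : set R[i]^o) (F : R[i] -> M -> M),
    [/\ open U, A `<=` U, holomorphic_on U F &
        forall z, A z -> inv_rel (shift_rel (Q z) mu) = graph_rel (F z)].

Definition nevanlinna_family (Q : R[i] -> set (M * M)) : Prop :=
  [/\ (forall z, upper_half z -> maximal_rel dissipative (Q z)) /\
      (forall z, lower_half z -> maximal_rel accumulative (Q z)),
      forall z, nonreal z -> adjoint_rel (Q z) = Q (z^*)%R,
      exists2 mu, upper_half mu & holomorphic_resolvent Q mu upper_half &
      exists2 mu, lower_half mu & holomorphic_resolvent Q mu lower_half].

(* The values of the family on the negative axis are those given by the analytic
   continuation, from either half-plane. *)
Definition continues_to_negative_axis (Q : R[i] -> set (M * M)) : Prop :=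
  (exists2 mu, upper_half mu &
     holomorphic_resolvent Q mu (upper_half `|` negative_axis)) /\
  (exists2 mu, lower_half mu &
     holomorphic_resolvent Q mu (lower_half `|` negative_axis)).

Definition stieltjes_family (Q : R[i] -> set (M * M)) : Prop :=
  [/\ nevanlinna_family Q, forall x, negative_axis x -> nonneg_rel (Q x) &
      continues_to_negative_axis Q].

Definition inverse_stieltjes_family (Q : R[i] -> set (M * M)) : Prop :=
  [/\ nevanlinna_family Q, forall x, negative_axis x -> nonpos_rel (Q x) &
      continues_to_negative_axis Q].

Definition RS (Om : R[i] -> M -> M) : Prop :=
  [/\ holomorphic_on RS_domain Om,
      forall z, nonreal z -> forall f g, dot (Om z f) g = dot f (Om (z^*)%R g),
      forall z, nonreal z -> forall f, 0 <= 'Im (dot (Om z f) f) / 'Im z &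
      forall x, -1 < x < 1 -> forall f, - dot f f <= dot (Om x f) f <= dot f f].

Definition mobius (z : R[i]) : R[i] := (1 + z) / (1 - z).

(* -I + 2 (I - Om((1 + z)/(1 - z)))^-1 *)
Definition Q_transform (Om : R[i] -> M -> M) (z : R[i]) : set (M * M) :=
  shift_rel
    (scale_rel 2 (inv_rel (graph_rel (fun h => h - Om (mobius z) h)))) (-1).

(* I - 2 (I + Om((1 + z)/(1 - z)))^-1 *)
Definition R_transform (Om : R[i] -> M -> M) (z : R[i]) : set (M * M) :=
  shift_rel
    (scale_rel (-2) (inv_rel (graph_rel (fun h => h + Om (mobius z) h)))) 1.

Definition Q_param (Om : R[i] -> M -> M) (z : R[i]) : set (M * M) :=
  [set (h - Om (mobius z) h, h + Om (mobius z) h) | h in setT].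

Definition R_param (Om : R[i] -> M -> M) (z : R[i]) : set (M * M) :=
  [set (h + Om (mobius z) h, Om (mobius z) h - h) | h in setT].

Definition neg_inv (Q : R[i] -> set (M * M)) (z : R[i]) : set (M * M) :=
  scale_rel (-1) (inv_rel (Q z)).

End Relations.

(* Main.v *)
(* Writing [s = 1] in the Stieltjes and [s = -1] in the inverse Stieltjes case, the
   relations in the statement are [{h - s T h, s h + T h}] with [T] a value of [Omega], and
   [Omega] is recovered as [s - 2 (Q + s)^-1]. In the direct part everything is algebra,
   except the resolvent of [Q] at [mu = i] or [- i]: it is an affine function of
   [(1 - mu Omega)^-1], which exists and is holomorphic because [1 - mu Omega] is coercive
   on the closed half-plane in question.

   In the converse the point is that [Q z + s] is boundedly invertible off the real axis,
   where dissipativity alone says nothing about the real point [- s]. Up to a constant,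
   [C z = (Q z + s) (Q z + mu)^-1] is [1] minus a contraction, so [Re (C z g, g) >= 0], and
   [C] is coercive near [-1] since [s Q (-1) >= 0]. The scalar functions [(C z g, g)] are
   holomorphic, and after sending [-1] to infinity the minimum principle bounds their real
   parts below on the whole half-plane, uniformly in [g]; so [C z] is coercive there too.
   The minimum principle is derived from Goursat's lemma on rectangles. *)

Require Import Defs.
From HB Require Import structures.
From mathcomp Require Import all_boot all_order all_algebra sesquilinear.
From mathcomp Require Import complex.
From mathcomp Require Import all_classical all_reals all_analysis.
From mathcomp Require Import ring lra.
Import Order.TTheory GRing.Theory Num.Theory numFieldNormedType.Exports.

Set Implicit Arguments.
Unset Strict Implicit.

Local Open Scope classical_set_scope.
Local Open Scope ring_scope.

(** In (b) the definition supplies two separate continuations, one from each half-plane, each with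
    its own [mu] and its own open neighbourhood of the negative axis. Each half-plane is therefore
    treated alone, under a sign [e], and yields its own version of [(Q + s)^-1]. On the axis both
    versions are determined by the values of [Q], so they agree there. Their complex derivatives
    agree too, being computable along the axis, so the two versions glue to a holomorphic function
    without any reflection principle.

    Coercivity is the common currency of both directions. A bounded coercive operator has a bounded
    inverse, and coercivity survives small perturbations, so a holomorphic family has a holomorphic
    inverse on the open set where it is coercive. This also produces the open neighbourhoods of the
    axis that the two classes require. The constant may depend on [z] but not on the vector [g],
    which is why the minimum principle is stated as an explicit bound, linear in the boundary
    value. *)

Section Complex.
Variable R : realType.
Implicit Types (a b z w : R[i]).

Local Notation cRe := (@complex.Re R).
Local Notation cIm := (@complex.Im R).
Local Notation normc := (@ComplexField.Normc.normc R).

Lemma cReD a b : cRe (a + b) = cRe a + cRe b. Proof. by case: a b => ? ? []. Qed.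
Lemma cImD a b : cIm (a + b) = cIm a + cIm b. Proof. by case: a b => ? ? []. Qed.
Lemma cReN a : cRe (- a) = - cRe a. Proof. by case: a. Qed.
Lemma cImN a : cIm (- a) = - cIm a. Proof. by case: a. Qed.
Lemma cReM a b : cRe (a * b) = cRe a * cRe b - cIm a * cIm b.
Proof. by case: a b => ? ? []. Qed.
Lemma cImM a b : cIm (a * b) = cRe a * cIm b + cIm a * cRe b.
Proof. by case: a b => ? ? []. Qed.
Lemma cRe_conj a : cRe a^* = cRe a. Proof. by case: a. Qed.
Lemma cIm_conj a : cIm a^* = - cIm a. Proof. by case: a. Qed.
Definition complexDE := (cReD, cImD, cReN, cImN, cReM, cImM, cRe_conj, cIm_conj).

Lemma complex_ext a b : cRe a = cRe b -> cIm a = cIm b -> a = b.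
Proof. by case: a b => ? ? [? ?] /= -> ->. Qed.

Lemma normc_normE z : `|z| = (normc z)%:C%C. Proof. by case: z. Qed.

Lemma normc_ge0 z : 0 <= normc z.
Proof. by case: z => x y; exact: sqrtr_ge0. Qed.

Lemma normc_sq z : normc z ^+ 2 = cRe z ^+ 2 + cIm z ^+ 2.
Proof. by case: z => x y /=; rewrite sqr_sqrtr// addr_ge0// sqr_ge0. Qed.

Lemma normc_gt0 z : (0 < normc z) = (z != 0).
Proof. by rewrite -ltcR -normc_normE normr_gt0. Qed.

Lemma normcB a b : normc (a - b) = normc (b - a).
Proof. by rewrite -normcN opprB. Qed.

Lemma normc_dist a b c : normc (a - c) <= normc (a - b) + normc (b - c).
Proof.
have -> : a - c = (a - b) + (b - c) by ring.
exact: le_normcD.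
Qed.

Lemma normc_conj a : normc a^* = normc a.
Proof. by case: a => x y /=; rewrite sqrrN. Qed.

Lemma cIm_div_real (x : R) z : cIm (x%:C%C / z) = - x * (cIm z / normc z ^+ 2).
Proof. by rewrite normc_sq; case: z => a b /=; ring. Qed.

Lemma normc_real (x : R) : normc x%:C%C = `|x|.
Proof. by rewrite /= expr0n addr0 sqrtr_sqr. Qed.

Lemma Re_le_normc z : `|cRe z| <= normc z.
Proof.
rewrite -(@ler_pXn2r _ 2) ?nnegrE ?normc_ge0// normc_sq real_normK ?num_real//.
by rewrite lerDl sqr_ge0.
Qed.

Lemma Im_le_normc z : `|cIm z| <= normc z.
Proof.
rewrite -(@ler_pXn2r _ 2) ?nnegrE ?normc_ge0// normc_sq real_normK ?num_real//.
by rewrite lerDr sqr_ge0.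
Qed.

Lemma normc_le_ReIm z : normc z <= `|cRe z| + `|cIm z|.
Proof.
rewrite -(@ler_pXn2r _ 2) ?nnegrE ?normc_ge0 ?addr_ge0// normc_sq sqrrD.
by rewrite !real_normK ?num_real// addrAC lerDl mulrn_wge0// mulr_ge0.
Qed.

Lemma gt0_complexP a : reflect (exists2 x : R, 0 < x & a = x%:C%C) (0 < a).
Proof.
apply: (iffP idP) => [|[x x0 ->]]; last by rewrite ltcR.
by case: a => x y; rewrite ltcE/= => /andP[/eqP-> ?]; exists x.
Qed.

Lemma ge0_complexE a : (0 <= a) = (cIm a == 0) && (0 <= cRe a).
Proof. by rewrite lecE /=. Qed.

Lemma nbhs_complexP (z : R[i]^o) (A : set R[i]) :
  nbhs z A <-> exists2 d : R, 0 < d & forall w, normc (w - z) < d -> A w.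
Proof.
split=> [/nbhs_ballP[e /gt0_complexP[d d0 ->] eA]|[d d0 dA]].
  exists d => // w wd; apply: eA; rewrite -ball_normE/= normc_normE ltcR.
  by rewrite normcB.
apply/nbhs_ballP; exists d%:C%C; first by rewrite /= ltcR.
move=> w; rewrite -ball_normE/= normc_normE ltcR normcB; exact: dA.
Qed.

Lemma open_complexP (A : set R[i]^o) :
  open A <-> forall z, A z -> exists2 d : R, 0 < d & forall w, normc (w - z) < d -> A w.
Proof.
rewrite openE; split=> [Ao z /Ao|Ao z /Ao]; rewrite /interior => /nbhs_complexP.
  by [].
by [].
Qed.

Lemma upper_halfE z : upper_half z <-> 0 < cIm z.
Proof. by rewrite /upper_half/= -complexIm ltcR. Qed.

Lemma lower_halfE z : lower_half z <-> cIm z < 0.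
Proof. by rewrite /lower_half/= -complexIm ltcR. Qed.

Lemma nonrealE z : nonreal z <-> cIm z != 0.
Proof.
rewrite /nonreal/= -complexIm -(inj_eq (@complexI R)).
by rewrite (_ : 0%:C%C = 0).
Qed.

Lemma negative_axisE z : negative_axis z <-> cIm z = 0 /\ cRe z < 0.
Proof.
rewrite /negative_axis/= ltcE/= eq_sym.
by split=> [/andP[/eqP ? ?]|[-> ->]]; rewrite ?eqxx.
Qed.

Lemma slit_planeE z : slit_plane z <-> nonreal z \/ negative_axis z.
Proof.
rewrite nonrealE negative_axisE /slit_plane/= ge0_complexE negb_and -ltNge.
split=> [/orP[|]|[->//|[-> ->]]]; [by left| |by rewrite orbT].
by case: eqP => [-> ?|/eqP ? _]; [right|left].
Qed.

Lemma nonreal_half z : nonreal z <-> upper_half z \/ lower_half z.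
Proof.
rewrite nonrealE upper_halfE lower_halfE neq_lt.
by split=> [/orP[]|[->|->]]; rewrite ?orbT//; [right|left].
Qed.

End Complex.
Notation cRe := (@complex.Re _).
Notation cIm := (@complex.Im _).
Notation normc := (@ComplexField.Normc.normc _).

(** * Hilbert spaces and operators *)

Section Hilbert.
Variables (R : realType) (M : completeNormedModType R[i]).
Variable dot : {dot M for (@Num.conj R[i])}.
Hypothesis dot_norm : forall f : M, `|f| ^+ 2 = dot f f.

Implicit Types (f g h k : M) (a b z : R[i]) (T : M -> M).

(** The norm of [M] takes values in [R[i]]; its real part brings the estimates into the ordered
    field [R], where [lra] and [nra] apply. *)
Definition nv f : R := cRe `|f|.

Lemma normE f : `|f| = (nv f)%:C%C.
Proof. by rewrite /nv RRe_real// normr_real. Qed.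

Lemma nv_ge0 f : 0 <= nv f. Proof. by rewrite -ler0c -normE. Qed.

Lemma nvD f g : nv (f + g) <= nv f + nv g.
Proof. by rewrite -lecR rmorphD/= -!normE ler_normD. Qed.

Lemma nvN f : nv (- f) = nv f. Proof. by rewrite /nv normrN. Qed.

Lemma nvZ a f : nv (a *: f) = normc a * nv f.
Proof. by apply: complexI; rewrite rmorphM/= -normc_normE -!normE normrZ. Qed.

Lemma nv0 : nv 0 = 0. Proof. by rewrite /nv normr0. Qed.

Lemma nv_eq0 f : (nv f == 0) = (f == 0).
Proof. by rewrite -(inj_eq (@complexI R)) -normE normr_eq0. Qed.

Lemma nvB f g : nv (f - g) = nv (g - f).
Proof. by rewrite -nvN opprB. Qed.

Lemma dotDl f g k : dot (f + g) k = dot f k + dot g k.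
Proof. exact: linearDl. Qed.
Lemma dotDr f g k : dot k (f + g) = dot k f + dot k g.
Proof. exact: linearDr. Qed.
Lemma dotNl f k : dot (- f) k = - dot f k.
Proof. exact: linearNl. Qed.
Lemma dotNr f k : dot k (- f) = - dot k f.
Proof. exact: linearNr. Qed.
Lemma dotZl a f k : dot (a *: f) k = a * dot f k.
Proof. exact: linearZl_LR. Qed.
Lemma dotZr a f k : dot k (a *: f) = a^* * dot k f.
Proof. exact: linearZr_LR. Qed.
Lemma dot0l k : dot 0 k = 0. Proof. exact: linear0l. Qed.
Lemma dot0r k : dot k 0 = 0. Proof. exact: linear0r. Qed.
Definition dotE :=
  (dotDl, dotDr, dotNl, dotNr, dotZl, dotZr, dot0l, dot0r).

Lemma dotC f g : dot f g = (dot g f)^*.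
Proof. by rewrite (@hermC _ _ _ _ dot) expr0 mul1r. Qed.

Lemma dot_sq f : dot f f = (nv f ^+ 2)%:C%C.
Proof. by rewrite -dot_norm normE rmorphXn. Qed.

Lemma Re_dotC f g : cRe (dot f g) = cRe (dot g f).
Proof. by rewrite dotC cRe_conj. Qed.
Lemma Im_dotC f g : cIm (dot f g) = - cIm (dot g f).
Proof. by rewrite dotC cIm_conj. Qed.
Lemma Re_dot_sq f : cRe (dot f f) = nv f ^+ 2. Proof. by rewrite dot_sq. Qed.

Lemma dot_inj f g : (forall k, dot f k = dot g k) -> f = g.
Proof.
move=> fg; apply/eqP; rewrite -subr_eq0 -nv_eq0.
have : nv (f - g) ^+ 2 = 0 by rewrite -Re_dot_sq dotDl dotNl fg subrr.
by move/eqP; rewrite expf_eq0.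
Qed.

(** Squaring the triangle inequality, which the norm of [M] already satisfies, leaves exactly this
    half of Cauchy-Schwarz. *)
Lemma Re_dot_le f g : cRe (dot f g) <= nv f * nv g.
Proof.
have := nvD f g; rewrite -(@ler_pXn2r _ 2) ?nnegrE ?addr_ge0 ?nv_ge0//.
rewrite -Re_dot_sq !dotE !complexDE !Re_dot_sq (Re_dotC g f) => H; lra.
Qed.

Lemma normc_dot_le f g : normc (dot f g) <= nv f * nv g.
Proof.
set t := dot f g; have [->|t0] := eqVneq t 0.
  by rewrite ComplexField.Normc.normc0 mulr_ge0 ?nv_ge0.
(* Multiplying [f] by the conjugate of [t] turns the inner product into the real number [|t|^2]; one
   factor [|t|] then cancels. *)
have := Re_dot_le (t^* *: f) g; rewrite dotZl -/t nvZ.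
rewrite normc_conj.
have -> : cRe (t^* * t) = normc t ^+ 2.
  by rewrite normc_sq !complexDE; ring.
by rewrite expr2 -mulrA ler_pM2l// normc_gt0.
Qed.

Section linear.
Variable T : M -> M.
Hypothesis linT : linear T.
Lemma linD f g : T (f + g) = T f + T g.
Proof. by have := linT 1 f g; rewrite !scale1r. Qed.
Lemma lin0 : T 0 = 0.
Proof. by have /eqP := linD 0 0; rewrite addr0 -subr_eq0 opprD addNKr oppr_eq0 => /eqP. Qed.
Lemma linZ a f : T (a *: f) = a *: T f.
Proof. by have := linT a f 0; rewrite lin0 !addr0. Qed.
Lemma linN f : T (- f) = - T f.
Proof. by rewrite -scaleN1r linZ scaleN1r. Qed.
Lemma linB f g : T (f - g) = T f - T g.
Proof. by rewrite linD linN. Qed.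
End linear.

Lemma bounded_opP T : bounded_op T <->
  linear T /\ exists2 c : R, 0 < c & forall f, nv (T f) <= c * nv f.
Proof.
split=> [[lT [c cT]]|[lT [c c0 cT]]]; split=> //; last first.
  by exists c%:C%C => f; rewrite !normE -rmorphM lecR.
exists (`|cRe c| + 1) => [|f]; first by rewrite ltr_wpDl.
have := cT f; rewrite !normE lecE cReM/= => /andP[_].
rewrite mulr0 subr0 => /le_trans; apply.
rewrite ler_wpM2r ?nv_ge0// (le_trans (ler_norm _))// lerDl//.
Qed.

Lemma bounded_op_lin (T : M -> M) : bounded_op T -> linear T. Proof. by case. Qed.

Lemma bounded_op_comp (T S : M -> M) :
  bounded_op T -> bounded_op S -> bounded_op (T \o S).
Proof.
move=> /bounded_opP[lT [c c0 cT]] /bounded_opP[lS [d d0 dS]].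
apply/bounded_opP; split=> [a f g /=|]; first by rewrite lS lT.
exists (c * d) => [|f /=]; first exact: mulr_gt0.
by rewrite (le_trans (cT _))// -mulrA ler_pM2l.
Qed.

Lemma bounded_op_affine a b (T : M -> M) :
  bounded_op T -> bounded_op (fun f => a *: f + b *: T f).
Proof.
move=> /bounded_opP[lT [c c0 cT]].
apply/bounded_opP; split=> [x f g /=|].
  by rewrite lT; apply: dot_inj => k; rewrite !dotE; ring.
exists (normc a + normc b * c + 1) => [|f].
  by rewrite ltr_wpDl// addr_ge0 ?normc_ge0// mulr_ge0 ?normc_ge0// ltW.
rewrite (le_trans (nvD _ _))// !nvZ.
have := ler_wpM2l (normc_ge0 b) (cT f); have := nv_ge0 f; lra.
Qed.

(** The operator-norm derivative with the denominator cleared: [z = z0] is not excluded, and one [d]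
    serves all [f]. *)
Definition has_cderiv (F : R[i] -> M -> M) z0 (D : M -> M) :=
  forall e : R, 0 < e -> exists2 d : R, 0 < d & forall z, normc (z - z0) < d ->
    forall f, nv (F z f - F z0 f - (z - z0) *: D f) <= e * normc (z - z0) * nv f.

Lemma holomorphic_atP (F : R[i] -> M -> M) z0 : holomorphic_at F z0 <->
  exists2 D, bounded_op D & has_cderiv F z0 D.
Proof.
split=> -[D bD FD]; exists D => // e e0.
  have /FD : 0 < e%:C%C :> R[i] by rewrite ltcR.
  move=> /nbhs_complexP[d d0 H]; exists d => // z zd f.
  have [->|zz0] := eqVneq z z0.
    by rewrite !subrr scale0r subrr nv0 ComplexField.Normc.normc0 mulr0 mul0r.
  have := H z zd zz0 f; rewrite !normE -rmorphM lecR => le.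
  have zz0' : z - z0 != 0 by rewrite subr_eq0.
  have -> : F z f - F z0 f - (z - z0) *: D f =
      (z - z0) *: ((z - z0)^-1 *: (F z f - F z0 f) - D f).
    by rewrite scalerBr scalerA mulfV// scale1r.
  by rewrite nvZ mulrAC [leRHS]mulrC ler_wpM2l ?normc_ge0.
have [e' e'0 ->] := gt0_complexP _ e0.
have [d d0 H] := FD _ e'0; apply/nbhs_complexP.
exists d => // z zd zz0 f; rewrite !normE -rmorphM lecR.
have zz0' : z - z0 != 0 by rewrite subr_eq0.
have -> : (z - z0)^-1 *: (F z f - F z0 f) - D f =
    (z - z0)^-1 *: (F z f - F z0 f - (z - z0) *: D f).
  by rewrite [RHS]scalerBr scalerA mulVf// scale1r.
rewrite nvZ ComplexField.Normc.normcV ler_pdivrMl ?normc_gt0//.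
by rewrite (le_trans (H z zd f))// mulrCA mulrA.
Qed.

End Hilbert.

(** * Inverses of bounded coercive operators *)

Section Inverse.
Variables (R : realType) (M : completeNormedModType R[i]).
Variable dot : {dot M for (@Num.conj R[i])}.
Hypothesis dot_norm : forall f : M, `|f| ^+ 2 = dot f f.

Implicit Types (f g h k : M) (a b z : R[i]).

Lemma contraction_fixpoint (Phi : M -> M) (q : R) : 0 <= q < 1 ->
  (forall g h, nv (Phi g - Phi h) <= q * nv (g - h)) -> exists p, Phi p = p.
Proof.
move=> /andP[q0 q1] ctr; pose u n := iter n Phi 0; pose d := nv (u 0%N - u 1%N).
have q1' : 0 < 1 - q by rewrite subr_gt0.
(* The outer induction uses the contraction; the inner one closes because
   [d + q d / (1 - q) = d / (1 - q)]. *)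
have dist n m : nv (u n - u (n + m)%N) <= q ^+ n * (d / (1 - q)).
  elim: n => [|n ih]; last first.
    by rewrite addSn (le_trans (ctr _ _))// exprS -mulrA ler_wpM2l.
  rewrite mul1r; elim: m => [|m ih].
    by rewrite addn0 subrr nv0 divr_ge0 ?nv_ge0// ltW.
  have -> : u 0%N - u (0 + m.+1)%N = (u 0%N - u 1%N) + (Phi (u 0%N) - Phi (u (0 + m)%N)).
    by rewrite addrA subrK.
  rewrite (le_trans (nvD _ _))// (le_trans (lerD (lexx _) (ctr _ _)))//.
  rewrite (le_trans (lerD (lexx _) (ler_wpM2l q0 ih)))// -/d.
  by rewrite le_eqVlt; apply/orP; left; apply/eqP; field; lra.
have small e : 0 < e -> exists N, forall n, (N <= n)%N -> q ^+ n * (d / (1 - q)) < e.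
  move=> e0; have : q ^+ n * (d / (1 - q)) @[n --> \oo] --> 0 * (d / (1 - q)).
    by apply: cvgMl; apply: cvg_expr; rewrite ger0_norm.
  rewrite mul0r => /cvgrPdist_lt/(_ _ e0)[N _ NP].
  exists N => n /NP /=; rewrite sub0r normrN => /(le_lt_trans (ler_norm _)); exact.
have : cvgn u.
  apply/cauchy_cvgP/cauchy_ballP => e /gt0_complexP[r r0 ->{e}].
  have [N NP] := small _ r0; near_simpl.
  exists ([set n | N <= n], [set n | N <= n])%N; first by split; exists N.
  move=> [n m] [/= Nn Nm]; rewrite -ball_normE /= normE ltcR.
  wlog nm : n m Nn Nm / (n <= m)%N => [W|].
    by case/orP: (leq_total n m) => /W; [|rewrite nvB]; apply.
  by rewrite -(subnKC nm) (le_lt_trans (dist _ _))// NP.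
move=> /cvg_ex[p up]; exists p; apply/eqP; rewrite -subr_eq0 -nv_eq0.
rewrite eq_le nv_ge0 andbT; apply/ler_addgt0Pl => e e0.
have e20 : 0 < e / 2 by rewrite divr_gt0.
have : 0 < (e / 2)%:C%C by rewrite ltcR.
move/cvgrPdist_lt: up => /[apply] -[N _ NP].
have := NP N (leqnn _); have := NP N.+1 (leqnSn _); rewrite /= !normE !ltcR.
rewrite addr0 => H1 H2.
have -> : Phi p - p = (Phi p - Phi (u N)) + (u N.+1 - p) by rewrite addrA subrK.
rewrite (le_trans (nvD _ _))// (nvB _ p).
have := ctr p (u N); have := nv_ge0 (p - u N).
move=> H3 H4; have : q * nv (p - u N) <= nv (p - u N) by rewrite ler_piMl// ltW.
lra.
Qed.

Definition coercive (c : R) (T : M -> M) :=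
  forall g, c * nv g ^+ 2 <= cRe (dot (T g) g).

Lemma coercive_bound (c : R) (T : M -> M) g : coercive c T -> c * nv g <= nv (T g).
Proof.
move=> cT; have [->|g0] := eqVneq g 0.
  by rewrite nv0 mulr0 nv_ge0.
have ng : 0 < nv g by rewrite lt_def nv_ge0 nv_eq0 g0.
rewrite -(ler_pM2r ng) -mulrA -expr2 (le_trans (cT g))//.
exact: (Re_dot_le dot_norm).
Qed.

(** The Lax-Milgram argument: a solution of [T h = g] is a fixed point of [h - rho (T h - g)], and
    [|k - rho T k|^2 <= (1 - 2 rho c + rho^2 K^2) |k|^2]. *)
Lemma coercive_inverse (c : R) (T : M -> M) : 0 < c -> bounded_op T -> coercive c T ->
  exists S : M -> M, [/\ bounded_op S, forall g, T (S g) = g,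
    forall g, S (T g) = g & forall g, c * nv (S g) <= nv g].
Proof.
move=> c0 /bounded_opP[lT [K0 K00 TK0]] cT.
(* Enlarging the bound by [c] forces [c <= K], hence [t <= 1], so that [1 - t / 2] is
   nonnegative. *)
pose K := K0 + c; have K_gt0 : 0 < K by rewrite addr_gt0.
have TK f : nv (T f) <= K * nv f.
  by rewrite (le_trans (TK0 f))// ler_wpM2r ?nv_ge0// lerDl ltW.
pose t := c ^+ 2 / K ^+ 2.
have t0 : 0 < t by rewrite divr_gt0// exprn_gt0.
have t1 : t <= 1.
  rewrite ler_pdivrMr ?exprn_gt0// mul1r ler_pXn2r ?nnegrE ?ltW//.
  by rewrite ltrDr.
(* This value minimises [1 - 2 rho c + rho^2 K^2]; the minimum [1 - t] is at most
   [(1 - t / 2)^2]. *)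
pose rho := c / K ^+ 2.
have surj g : exists h, T h = g.
  have [|f h|p] := @contraction_fixpoint
      (fun h => h - rho%:C%C *: (T h - g)) (1 - t / 2).
  - by apply/andP; split; lra.
  - set k := f - h.
    have -> : f - rho%:C%C *: (T f - g) - (h - rho%:C%C *: (T h - g)) =
        k - rho%:C%C *: T k.
      by rewrite /k (linB lT); apply: (dot_inj dot_norm) => l; rewrite !dotE; ring.
    clearbody k; have q0 : 0 <= 1 - t / 2 by lra.
    rewrite -(@ler_pXn2r _ 2) ?nnegrE ?nv_ge0 ?mulr_ge0 ?nv_ge0//.
    rewrite -(Re_dot_sq dot_norm) !dotE !complexDE/=.
    rewrite !(Re_dot_sq dot_norm) (Re_dotC dot k (T k)).
    have A := cT k.
    have B : nv (T k) ^+ 2 <= K ^+ 2 * nv k ^+ 2.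
      by rewrite -exprMn ler_pXn2r ?nnegrE ?nv_ge0 ?mulr_ge0 ?nv_ge0 ?(ltW K_gt0).
    have rho0 : 0 < rho by rewrite divr_gt0// exprn_gt0.
    have E1 : rho * c = t by rewrite /rho /t; field; rewrite gt_eqF.
    have E2 : rho * rho * K ^+ 2 = t by rewrite /rho /t; field; rewrite gt_eqF.
    have A' := ler_wpM2l (ltW rho0) A; rewrite [rho * _]mulrA E1 in A'.
    have B' := ler_wpM2l (ltW (mulr_gt0 rho0 rho0)) B.
    rewrite (mulrA (rho * rho) (K ^+ 2)) E2 in B'.
    rewrite exprMn.
    have : 0 <= t ^+ 2 * nv k ^+ 2 by rewrite mulr_ge0// sqr_ge0.
    clear -t0 t1 E1 E2 A' B'; nra.
  - move=> /eqP; rewrite -subr_eq0 addrAC subrr sub0r oppr_eq0 scaler_eq0.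
    rewrite subr_eq0 => /orP[/eqP/(congr1 cRe)/= rho0|/eqP <-]; last by exists p.
    have : 0 < rho by rewrite divr_gt0// exprn_gt0.
    by rewrite rho0 ltxx.
pose S g := projT1 (cid (surj g)).
have TS g : T (S g) = g by rewrite /S; case: cid.
have injT f g : T f = T g -> f = g.
  move=> fg; apply/eqP; rewrite -subr_eq0 -nv_eq0 eq_le nv_ge0 andbT.
  have := coercive_bound (f - g) cT; rewrite (linB lT) fg subrr nv0.
  by rewrite pmulr_rle0.
have bS g : c * nv (S g) <= nv g by rewrite -{2}(TS g) coercive_bound.
exists S; split=> //; last by move=> g; apply: injT.
apply/bounded_opP; split=> [a f g|].
  by apply: injT; rewrite TS lT !TS.
exists c^-1 => [|f]; first by rewrite invr_gt0.
by rewrite ler_pdivlMl.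
Qed.

End Inverse.

(** * Calculus of operator-valued holomorphic functions *)

Section Holomorphy.
Variables (R : realType) (M : completeNormedModType R[i]).
Variable dot : {dot M for (@Num.conj R[i])}.
Hypothesis dot_norm : forall f : M, `|f| ^+ 2 = dot f f.

Implicit Types (f g h k : M) (a b z : R[i]) (F : R[i] -> M -> M).

Lemma holomorphic_at_affine F a b z0 : holomorphic_at F z0 ->
  holomorphic_at (fun z f => a *: f + b *: F z f) z0.
Proof.
move=> /holomorphic_atP[D bD FD]; apply/holomorphic_atP.
exists (fun f => b *: D f) => [|e e0].
  have := bounded_op_affine dot_norm 0 b bD; congr bounded_op.
  by apply/funext => f; rewrite scale0r add0r.
have nb : 0 < normc b + 1 by rewrite ltr_wpDl// normc_ge0.
have [|d d0 dF] := FD (e / (normc b + 1)); first by rewrite divr_gt0.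
exists d => // z zd f.
have -> : a *: f + b *: F z f - (a *: f + b *: F z0 f) - (z - z0) *: (b *: D f) =
    b *: (F z f - F z0 f - (z - z0) *: D f).
  by apply: (dot_inj dot_norm) => l; rewrite !dotE; ring.
rewrite nvZ.
have := ler_wpM2l (normc_ge0 b) (dF z zd f).
move=> /le_trans; apply; rewrite !mulrA ler_wpM2r ?nv_ge0// ler_wpM2r ?normc_ge0//.
by rewrite ler_pdivrMr// [leLHS]mulrC ler_wpM2l ?(ltW e0)// lerDl.
Qed.

Lemma holomorphic_at_lipschitz F z0 : holomorphic_at F z0 ->
  exists2 K : R, 0 < K & exists2 d : R, 0 < d & forall z, normc (z - z0) < d ->
    forall f, nv (F z f - F z0 f) <= K * normc (z - z0) * nv f.
Proof.
move=> /holomorphic_atP[D /bounded_opP[lD [K K0 DK]] FD].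
exists (K + 1); first by rewrite addr_gt0.
have [//|d d0 dF] := FD 1; exists d => // z zd f.
rewrite -(subrK ((z - z0) *: D f) (_ - _)) (le_trans (nvD _ _))// nvZ.
have := dF z zd f; have := ler_wpM2l (normc_ge0 (z - z0)) (DK f); lra.
Qed.

Definition scalar_cderiv (phi : R[i] -> R[i]) z0 l :=
  forall e : R, 0 < e -> exists2 d : R, 0 < d & forall z, normc (z - z0) < d ->
    normc (phi z - phi z0 - (z - z0) * l) <= e * normc (z - z0).

Lemma scalar_cderiv_lipschitz phi z0 l : scalar_cderiv phi z0 l ->
  exists2 K : R, 0 < K & exists2 d : R, 0 < d & forall z, normc (z - z0) < d ->
    normc (phi z - phi z0) <= K * normc (z - z0).
Proof.
move=> phil; exists (normc l + 1); first by rewrite ltr_wpDl// normc_ge0.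
have [//|d d0 dF] := phil 1; exists d => // z zd.
rewrite -(subrK ((z - z0) * l) (_ - _)) (le_trans (le_normcD _ _))//.
rewrite ComplexField.Normc.normcM; have := dF z zd; lra.
Qed.

Lemma scalar_cderiv_moebius a b c z0 : z0 != c ->
  scalar_cderiv (fun z => a + b / (z - c)) z0 (- b / (z0 - c) ^+ 2).
Proof.
rewrite -subr_eq0 => z0c e e0.
set r := normc (z0 - c); have r0 : 0 < r by rewrite normc_gt0.
have nb : 0 < normc b + 1 by rewrite ltr_wpDl// normc_ge0.
(* The remainder is exactly [b (z - z0)^2 / ((z0 - c)^2 (z - c))]. The first radius keeps
   [|z - c| >= r / 2]; the second then bounds the remainder, its [+ 1] covering [b = 0]. *)
pose d := Num.min (r / 2) (e * r ^+ 3 / (2 * (normc b + 1))).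
exists d => [|z zd].
  by rewrite lt_min !divr_gt0// mulr_gt0// exprn_gt0.
have [zd1 zd2] : normc (z - z0) < r / 2 /\
    normc (z - z0) * (2 * (normc b + 1)) < e * r ^+ 3.
  move: zd; rewrite /d lt_min => /andP[->]; rewrite ltr_pdivlMr//; exact: mulr_gt0.
have zr : r / 2 <= normc (z - c).
  have := normc_dist z0 z c; rewrite -/r (normcB z0). lra.
have zc : z - c != 0 by rewrite -normc_gt0 (lt_le_trans _ zr)// divr_gt0.
have -> : a + b / (z - c) - (a + b / (z0 - c)) - (z - z0) * (- b / (z0 - c) ^+ 2) =
    b * (z - z0) ^+ 2 / ((z0 - c) ^+ 2 * (z - c)).
  by field; rewrite z0c zc.
rewrite !expr2 !(ComplexField.Normc.normcM, ComplexField.Normc.normcV) -/r.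
set t := normc (z - z0) in zd1 zd2 *; have t0 : 0 <= t := normc_ge0 _.
set s := normc (z - c) in zr *.
rewrite ler_pdivrMr; last by rewrite !mulr_gt0// (lt_le_trans _ zr)// divr_gt0.
rewrite mulrA mulrAC -[e * t * _]mulrA mulrCA [leRHS]mulrC ler_wpM2r//.
have s1 : e * (r * r * (r / 2)) <= e * (r * r * s).
  by rewrite ler_wpM2l ?(ltW e0)// ler_wpM2l// mulr_ge0// ltW.
have := normc_ge0 b; move: s1 zd2; rewrite !exprS expr0; nra.
Qed.

Lemma holomorphic_at_comp F phi z0 l : scalar_cderiv phi z0 l ->
  holomorphic_at F (phi z0) -> holomorphic_at (fun z => F (phi z)) z0.
Proof.
move=> phil /holomorphic_atP[D bD FD]; apply/holomorphic_atP.
have /bounded_opP[lD [K K0 DK]] := bD.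
have [L L0 [d1 d10 Ld]] := scalar_cderiv_lipschitz phil.
exists (fun f => l *: D f) => [|e e0].
  have := bounded_op_affine dot_norm 0 l bD; congr bounded_op.
  by apply/funext => f; rewrite scale0r add0r.
have [|d2 d20 dF] := FD (e / (2 * L)); first by rewrite divr_gt0// mulr_gt0.
have [|d3 d30 dphi] := phil (e / (2 * K)); first by rewrite divr_gt0// mulr_gt0.
exists (Num.min d1 (Num.min (d2 / L) d3)) => [|z].
  by rewrite !lt_min d10 d30 divr_gt0.
rewrite !lt_min => /and3P[zd1 zd2 zd3] f.
have phiL := Ld z zd1.
(* The remainder of [F] at [phi z], controlled by the Lipschitz constant [L] of [phi], plus the
   remainder of [phi] times [D], controlled by [K]; each is allotted [e / 2]. *)
have -> : F (phi z) f - F (phi z0) f - (z - z0) *: (l *: D f) =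
   (F (phi z) f - F (phi z0) f - (phi z - phi z0) *: D f) +
   (phi z - phi z0 - (z - z0) * l) *: D f.
  by apply: (dot_inj dot_norm) => k; rewrite !dotE; ring.
rewrite (le_trans (nvD _ _))// nvZ.
have n0 := nv_ge0 f; have t0 := normc_ge0 (z - z0).
have H1 : nv (F (phi z) f - F (phi z0) f - (phi z - phi z0) *: D f) <=
    e / 2 * normc (z - z0) * nv f.
  rewrite (le_trans (dF _ _ f))//.
    by rewrite (le_lt_trans phiL)// mulrC -ltr_pdivlMr.
  rewrite ler_wpM2r//.
  have -> : e / 2 * normc (z - z0) = e / (2 * L) * (L * normc (z - z0)).
    by field; rewrite gt_eqF.
  by rewrite ler_wpM2l// divr_ge0 ?ltW// mulr_gt0.
have H2 : normc (phi z - phi z0 - (z - z0) * l) * nv (D f) <=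
    e / 2 * normc (z - z0) * nv f.
  have -> : e / 2 * normc (z - z0) * nv f = (e / (2 * K) * normc (z - z0)) * (K * nv f).
    by field; rewrite gt_eqF.
  by rewrite ler_pM ?normc_ge0 ?nv_ge0// dphi.
lra.
Qed.

(** The constant is chosen at each point: the converse only provides one that depends on [z], and
    openness uses it locally. *)
Definition coercive_set (W : set R[i]) (A : R[i] -> M -> M) : set R[i] :=
  [set z | W z /\ exists2 c : R, 0 < c & coercive dot c (A z)].

Lemma coercive_near A z0 (c : R) : 0 < c -> holomorphic_at A z0 ->
  coercive dot c (A z0) ->
  exists2 d : R, 0 < d & forall z, normc (z - z0) < d -> coercive dot (c / 2) (A z).
Proof.
move=> c0 /holomorphic_at_lipschitz[K K0 [d d0 Ad]] cA.
exists (Num.min d (c / 2 / K)) => [|z]; first by rewrite lt_min d0 !divr_gt0.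
rewrite lt_min ltr_pdivlMr// => /andP[zd zc] g.
have := Re_dot_le dot_norm (A z0 g - A z g) g.
rewrite dotDl dotNl !complexDE; have := cA g.
have := Ad z zd g; rewrite nvB => H1 H2 H3.
have H4 : nv (A z0 g - A z g) * nv g <= c / 2 * nv g ^+ 2.
  rewrite expr2 mulrA ler_wpM2r ?nv_ge0// (le_trans H1)//.
  by rewrite ler_wpM2r ?nv_ge0// mulrC ltW.
lra.
Qed.

Lemma coercive_set_open (W : set R[i]^o) A : open W -> holomorphic_on W A ->
  open (coercive_set W A : set R[i]^o).
Proof.
move=> /open_complexP Wo hA; apply/open_complexP => z [Wz [c c0 cA]].
have [d1 d10 dW] := Wo z Wz.
have [d2 d20 dA] := coercive_near c0 (proj2 (hA z Wz)) cA.
exists (Num.min d1 d2) => [|w]; first by rewrite lt_min d10.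
rewrite lt_min => /andP[w1 w2]; split; first exact: dW.
by exists (c / 2); [rewrite divr_gt0|exact: dA].
Qed.

Lemma inverse_holomorphic (W : set R[i]^o) A : open W -> holomorphic_on W A ->
  exists2 B : R[i] -> M -> M, holomorphic_on (coercive_set W A) B &
    forall z, coercive_set W A z -> cancel (A z) (B z) /\ cancel (B z) (A z).
Proof.
move=> Wo hA; have Uo := coercive_set_open Wo hA.
(* The bound is recorded for every coercivity constant of [A z], since near [z0] it is used with
   [c / 2]. Off the coercive set [id] is a default value. *)
have inv z : exists S : M -> M, coercive_set W A z ->
    [/\ bounded_op S, cancel (A z) S, cancel S (A z) & forall c : R, 0 < c ->
      coercive dot c (A z) -> forall g, c * nv (S g) <= nv g].
  have [[Wz [c c0 cA]]|nUz] := pselect (coercive_set W A z); last by exists id.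
  have [S [bS AS SA _]] := coercive_inverse dot_norm c0 (proj1 (hA z Wz)) cA.
  exists S => _; split=> // c' c'0 c'A g.
  by rewrite -{2}(AS g) (coercive_bound dot_norm).
have [B HB] := choice inv; exists B; last by move=> z /HB[].
move=> z0 Uz0; have [bB0 _ AB0 _] := HB _ Uz0; split=> //.
have [Wz0 [c c0 cA0]] := Uz0.
have [bA0 hA0] := hA _ Wz0.
have [d1 d10 dU] := (open_complexP _).1 Uo _ Uz0.
have [d2 d20 dA] := coercive_near c0 hA0 cA0.
have [L L0 [d3 d30 dL]] := holomorphic_at_lipschitz hA0.
have /holomorphic_atP[D bD AD] := hA0.
have /bounded_opP[lB0 [K K0 BK]] := bB0.
have /bounded_opP[lD [N N0 DN]] := bD.
(* The derivative of the inverse is [- A^-1 A' A^-1]. *)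
apply/holomorphic_atP; exists (fun f => - B z0 (D (B z0 f))) => [|e e0].
  have := bounded_op_affine dot_norm 0 (-1) (bounded_op_comp bB0 (bounded_op_comp bD bB0)).
  by congr bounded_op; apply/funext => f; rewrite scale0r add0r scaleN1r.
have c20 : 0 < c / 2 by rewrite divr_gt0.
have [|d4 d40 dD] := AD (e * (c / 2) / (2 * K)).
  by rewrite divr_gt0 ?mulr_gt0.
pose d5 := e * (c / 2) / (2 * L * K * N * K).
have d50 : 0 < d5 by rewrite divr_gt0 ?mulr_gt0.
exists (Num.min (Num.min d1 d2) (Num.min (Num.min d3 d4) d5)) => [|z].
  by rewrite !lt_min d10 d20 d30 d40.
rewrite !lt_min => /andP[/andP[z1 z2] /andP[/andP[z3 z4] z5]] f.
have [bB BA AB Bc] := HB _ (dU z z1).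
have lB := bounded_op_lin bB.
have cB g : nv (B z g) <= (c / 2)^-1 * nv g.
  by rewrite ler_pdivlMl// Bc//; exact: dA.
set t := normc (z - z0); have t0 : 0 <= t := normc_ge0 _.
(* Apply [A z] to the remainder of [B]. Since [A z0 h = f] and [A z0 k = D h], the result consists
   of the remainder of [A] at [h], of order [o(t)], and [z - z0] times the increment of [A] at [k],
   of order [O(t^2)]. *)
pose h := B z0 f; pose k := B z0 (D h).
have -> : B z f - B z0 f - (z - z0) *: (- B z0 (D (B z0 f))) =
    - B z ((A z h - A z0 h - (z - z0) *: D h) - (z - z0) *: (A z k - A z0 k)).
  rewrite [A z0 k]AB0 [A z0 h]AB0 !(linB lB, linZ lB) !BA -/h -/k.
  by apply: (dot_inj dot_norm) => l; rewrite !dotE; ring.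
rewrite nvN (le_trans (cB _))// ler_pdivrMl//.
rewrite (le_trans (nvD _ _))// nvN nvZ -/t.
have hf : nv h <= K * nv f := BK f.
have kf : nv k <= K * N * (K * nv f).
  by rewrite (le_trans (BK _))// -mulrA ler_wpM2l ?(ltW K0)// (le_trans (DN _))//
    ler_wpM2l ?(ltW N0).
have nf := nv_ge0 f.
have H1 : nv (A z h - A z0 h - (z - z0) *: D h) <= e * (c / 2) / 2 * t * nv f.
  rewrite (le_trans (dD z z4 h))// -/t.
  have -> : e * (c / 2) / 2 * t * nv f = e * (c / 2) / (2 * K) * t * (K * nv f).
    by field; rewrite gt_eqF.
  by rewrite ler_wpM2l// mulr_ge0// divr_ge0// ?mulr_ge0// ltW// ?mulr_gt0.
have H2 : nv (A z k - A z0 k) <= e * (c / 2) / 2 * nv f.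
  rewrite (le_trans (dL z z3 k))// -/t.
  have -> : e * (c / 2) / 2 * nv f = L * d5 * (K * N * (K * nv f)).
    by rewrite /d5; field; rewrite !gt_eqF.
  by rewrite ler_pM ?nv_ge0 ?mulr_ge0 ?(ltW L0)// ler_wpM2l ?(ltW L0)// ltW.
have H3 := ler_wpM2l t0 H2.
lra.
Qed.

End Holomorphy.

(** * Goursat's lemma and a minimum principle *)

Section RealCalculus.
Variable R : realType.
Implicit Types (x y t a b c d e l : R) (f g : R -> R) (P Q : R -> R -> R).

Lemma is_derive_eps f x l : is_derive x 1 f l ->
  forall e, 0 < e -> exists2 d, 0 < d &
    forall t, `|t - x| < d -> `|f t - f x - (t - x) * l| <= e * `|t - x|.
Proof.
move=> fl e e0; have := @derivable_nbhs _ _ _ f x 1 (@ex_derive _ _ _ _ _ _ _ fl).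
rewrite (@derive_val _ _ _ _ _ _ _ fl).
move=> /eqaddoP/(_ _ e0)/nbhs_ballP[d d0 H]; exists d => // t td.
have := H (t - x); rewrite -ball_normE/= sub0r normrN => /(_ td).
rewrite !fctE /= [_%:A]mulr1 subrK !opprD addrA.
exact.
Qed.

Lemma mvt f f' a b : a < b -> (forall t, a <= t <= b -> is_derive t 1 f (f' t)) ->
  exists2 t, a < t < b & f b - f a = f' t * (b - a).
Proof.
move=> ab df; have [t||t] := @MVT R f f' a b ab.
- by rewrite in_itv/= => /andP[? ?]; apply: df; rewrite !ltW.
- apply: derivable_within_continuous => t; rewrite in_itv/= => tab.
  exact: (@ex_derive _ _ _ _ _ _ _ (df t tab)).
by rewrite in_itv/= => tab ->; exists t.
Qed.

Lemma mvt_bound f f' (K a b : R) :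
  (forall t, Num.min a b <= t <= Num.max a b -> is_derive t 1 f (f' t)) ->
  (forall t, Num.min a b <= t <= Num.max a b -> `|f' t| <= K) ->
  `|f b - f a| <= K * `|b - a|.
Proof.
wlog ab : a b / a <= b => [H|].
  case/orP: (le_total a b) => ab; first exact: H.
  by rewrite distrC (distrC b) minC maxC; exact: H.
rewrite (min_idPl ab) (max_idPr ab) => df f'K.
have [<-|anb] := eqVneq a b; first by rewrite !subrr normr0 mulr0.
have [|t /andP[at_ tb] ->] := mvt _ df; first by rewrite lt_neqAle anb.
by rewrite normrM ler_wpM2r// f'K// !ltW.
Qed.

(** If [l < 0], then [f'] is negative just to the right of [x] when [f' x <= 0], and positive just
    to the left when [f' x > 0]. Either way [f] takes a value below [f x]. *)
Lemma second_derivative_at_min f f' a b x l : a < x < b ->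
  (forall t, a < t < b -> is_derive t 1 f (f' t)) -> is_derive x 1 f' l ->
  (forall t, a < t < b -> f x <= f t) -> 0 <= l.
Proof.
move=> /andP[ax xb] df df' fmin; rewrite leNgt; apply/negP => l0.
have [|d d0 H] := is_derive_eps df' (e := - l / 2); first by lra.
case: (leP (f' x) 0) => f'x.
- pose t := Num.min (x + d / 2) ((x + b) / 2).
  have [xt td tb] : [/\ x < t, t < x + d & t < b].
    by rewrite /t; case: (ltP (x + d / 2)) => ?; split; lra.
  have [s|s /andP[xs st] E] := mvt (f := f) (f' := f') xt.
    by move=> /andP[? ?]; apply: df; apply/andP; split; lra.
  have sd : `|s - x| < d by rewrite gtr0_norm; lra.
  have := H s sd; rewrite (gtr0_norm (x := s - x)) ?subr_gt0// => Hs.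
  have := le_trans (ler_norm _) Hs => {}Hs.
  have sl : (s - x) * l < 0 by rewrite pmulr_rlt0 ?subr_gt0.
  have f's : f' s < 0 by lra.
  have : f' s * (t - x) < 0 by rewrite nmulr_rlt0 ?subr_gt0.
  have : f x <= f t by apply: fmin; apply/andP; split; lra.
  lra.
- pose t := Num.max (x - d / 2) ((x + a) / 2).
  have [xt td tb] : [/\ t < x, x - d < t & a < t].
    by rewrite /t; case: (ltP (x - d / 2)) => ?; split; lra.
  have [s|s /andP[xs st] E] := mvt (f := f) (f' := f') xt.
    by move=> /andP[? ?]; apply: df; apply/andP; split; lra.
  have sd : `|s - x| < d by rewrite ltr0_norm; lra.
  have := H s sd; rewrite (ltr0_norm (x := s - x)) ?subr_lt0// => Hs.
  rewrite -normrN in Hs; have := le_trans (ler_norm _) Hs => {}Hs.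
  have sl : 0 < (s - x) * l by rewrite nmulr_rgt0 ?subr_lt0.
  have f's : 0 < f' s by lra.
  have : 0 < f' s * (x - t) by rewrite mulr_gt0 ?subr_gt0.
  have : f x <= f t by apply: fmin; apply/andP; split; lra.
  lra.
Qed.

(** The integral starts at [b > a], so that the integrand is continuous up to and including the left
    end. *)
Lemma primitive f a b : a < b -> (forall t, a < t -> {for t, continuous f}) ->
  exists F : R -> R, forall t, b < t -> is_derive t 1 F (f t).
Proof.
move=> ab cf.
exists (fun t => \int[lebesgue_measure]_(s in `[b, t]) f s)%R => t bt.
have := @continuous_FTC1_closed R f b t (t + 1); case.
- by rewrite ltrDl.
- apply: continuous_compact_integrable; first exact: segment_compact.
  apply: continuous_in_subspaceT => s /set_mem /=; rewrite in_itv/= => /andP[bs _].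
  by apply: cf; exact: lt_le_trans bs.
- exact: bt.
- by apply: cf; exact: lt_trans bt.
by move=> dF; rewrite derive1E => F't; exact: (DeriveDef dF F't).
Qed.

(** Total differentiability, with the sum norm on the plane. Goursat's estimate needs the affine
    approximation on whole small rectangles, which partial derivatives would not give. *)
Definition has_grad P x0 y0 a b := forall e, 0 < e -> exists2 d, 0 < d &
  forall x y, `|x - x0| < d -> `|y - y0| < d ->
    `|P x y - P x0 y0 - (a * (x - x0) + b * (y - y0))| <=
      e * (`|x - x0| + `|y - y0|).

Lemma eps_is_derive f x l :
  (forall e, 0 < e -> exists2 d, 0 < d &
    forall t, `|t - x| < d -> `|f t - f x - (t - x) * l| <= e * `|t - x|) ->
  is_derive x 1 f l.
Proof.
move=> H.
have L : (h^-1 *: (f (h *: 1 + x) - f x))%R @[h --> 0^'] --> l.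
  apply/cvgrPdist_le => e /H[d d0 He].
  apply/nbhs_ballP; exists d => // h; rewrite -ball_normE/= sub0r normrN => hd h0.
  have := He (h + x); rewrite addrK => /(_ hd).
  rewrite /GRing.scale/= mulr1 => {}He.
  suff : `|h^-1 * (f (h + x) - f x - h * l)| <= e.
    by rewrite mulrBr mulKf// distrC.
  by rewrite normrM normfV mulrC ler_pdivrMr ?normr_gt0.
apply: DeriveDef; first by apply/cvg_ex; exists l.
exact: cvg_lim.
Qed.

Lemma has_grad_x P x y a b : has_grad P x y a b -> is_derive x 1 (P ^~ y) a.
Proof.
move=> gP; apply: eps_is_derive => e /gP[d d0 H]; exists d => // t td.
have := H t y td; rewrite !subrr normr0 mulr0 !addr0 => /(_ d0).
by rewrite mulrC.
Qed.

Lemma has_grad_y P x y a b : has_grad P x y a b -> is_derive y 1 (P x) b.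
Proof.
move=> gP; apply: eps_is_derive => e /gP[d d0 H]; exists d => // t td.
have := H x t; rewrite !subrr normr0 mulr0 !add0r => /(_ d0 td).
by rewrite mulrC.
Qed.

Lemma has_gradN P x y a b : has_grad P x y a b ->
  has_grad (fun x y => - P x y) x y (- a) (- b).
Proof.
move=> gP e /gP[d d0 H]; exists d => // s t sd td.
rewrite -normrN; apply: le_trans (H s t sd td).
by rewrite le_eqVlt; apply/orP; left; apply/eqP; congr `|_|; ring.
Qed.

Lemma has_grad_bounded P x y a b : has_grad P x y a b ->
  exists2 K : R, 0 < K & exists2 d, 0 < d &
    forall s t, `|s - x| < d -> `|t - y| < d -> `|P s t| <= K.
Proof.
move=> /(_ 1 ltr01)[d d0 H]; exists (`|P x y| + (`|a| + `|b| + 2) * d + 1).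
  by rewrite ltr_wpDl// addr_ge0// mulr_ge0 ?ltW// ltW.
exists d => // s t sd td.
rewrite -(subrK (P x y) (P s t)) -(subrK (a * (s - x) + b * (t - y)) (_ - _)).
rewrite (le_trans (ler_normD _ _))// (le_trans (lerD (ler_normD _ _) (lexx _)))//.
have := H s t sd td; have := ler_normD (a * (s - x)) (b * (t - y)).
rewrite !normrM; have := ler_wpM2l (normr_ge0 a) (ltW sd).
have := ler_wpM2l (normr_ge0 b) (ltW td).
lra.
Qed.

End RealCalculus.

(** * Goursat's lemma for closed differential forms *)

Section Goursat.
Variable R : realType.
Implicit Types (x y t a b c d e l : R) (P Q : R -> R -> R).

Lemma nested_intervals (a : nat -> R) l : 0 <= l ->
  (forall n, a n <= a n.+1 /\ a n.+1 + l / 2 ^+ n.+1 <= a n + l / 2 ^+ n) ->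
  exists x, forall n, a n <= x <= a n + l / 2 ^+ n.
Proof.
move=> l0 Ha.
have inc m n : (m <= n)%N -> a m <= a n.
  by move=> /subnKC <-; elim: (n - m)%N => [|k ih]; rewrite ?addn0// addnS
    (le_trans ih)// (Ha _).1.
have dec m n : (m <= n)%N -> a n + l / 2 ^+ n <= a m + l / 2 ^+ m.
  by move=> /subnKC <-; elim: (n - m)%N => [|k ih]; rewrite ?addn0// addnS
    (le_trans _ ih)// (Ha _).2.
have p0 n : 0 <= l / 2 ^+ n by rewrite divr_ge0// exprn_ge0.
have ub n : ubound (range a) (a n + l / 2 ^+ n).
  move=> _ [m _ <-]; case/orP: (leq_total m n) => mn.
    by rewrite (le_trans (inc _ _ mn))// lerDl.
  by rewrite (le_trans _ (dec _ _ mn))// lerDl.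
exists (sup (range a)) => n; apply/andP; split.
  by apply: ub_le_sup; [exists (a 0%N + l / 2 ^+ 0)|exists n].
by apply: ge_sup; [exists (a 0%N); exists 0%N|exact: ub].
Qed.

Lemma half_pow_small (l d : R) : 0 < d -> exists n, l / 2 ^+ n < d.
Proof.
move=> d0; exists (Num.bound (`|l| / d)).
rewrite ltr_pdivrMr ?exprn_gt0// mulrC -ltr_pdivrMr//.
apply: le_lt_trans (ler_wpM2r _ (ler_norm l)) _; first by rewrite invr_ge0 ltW.
rewrite (lt_trans (archi_boundP _))//; first by rewrite divr_ge0// ltW.
by rewrite -natrX ltr_nat ltn_expl.
Qed.

Variables (P Q A B : R -> R -> R) (xb yb : R).
Hypothesis dA : forall x y, xb < x -> yb < y -> is_derive x 1 (A ^~ y) (P x y).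
Hypothesis dB : forall x y, xb < x -> yb < y -> is_derive y 1 (B x) (Q x y).
(** The shared entry [b] expresses [P_y = Q_x] at each point; no continuity of the partial
    derivatives is assumed. The primitives [A] and [B] replace integrals along horizontal and
    vertical segments. *)
Hypothesis closed_form : forall x y, xb < x -> yb < y -> exists a b c,
  has_grad P x y a b /\ has_grad Q x y b c.

(* The integral of [P dx + Q dy] along the boundary of a rectangle. *)
Let circ x1 x2 y1 y2 := (A x2 y1 - A x1 y1) + (B x2 y2 - B x2 y1)
  - (A x2 y2 - A x1 y2) - (B x1 y2 - B x1 y1).

(** The affine parts of [P] and [Q] at [(x0, y0)] contribute [- b l k + b k l = 0]; only the four
    remainders survive, each at most [e / 2 * (k + l)]. *)
Lemma goursat_local x0 y0 : xb < x0 -> yb < y0 -> forall e, 0 < e ->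
  exists2 d, 0 < d & forall x1 y1 k l, xb < x1 -> yb < y1 -> 0 < k -> 0 < l ->
    k < d -> l < d -> x1 <= x0 <= x1 + k -> y1 <= y0 <= y1 + l ->
    `|circ x1 (x1 + k) y1 (y1 + l)| <= e * (k + l) ^+ 2.
Proof.
move=> x0b y0b e e0; have [a [b [c [gP gQ]]]] := closed_form x0b y0b.
have e2 : 0 < e / 2 by lra.
have [d1 d10 H1] := gP _ e2; have [d2 d20 H2] := gQ _ e2.
exists (Num.min d1 d2) => [|x1 y1 k l x1b y1b k0 l0]; first by rewrite lt_min d10.
rewrite !lt_min => /andP[k1 k2] /andP[l1 l2] /andP[x01 x02] /andP[y01 y02].
have xk : x1 < x1 + k by rewrite ltrDl.
have yl : y1 < y1 + l by rewrite ltrDl.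
(* Opposite sides are subtracted before the mean value theorem is applied, so that a single [s] (and
   below a single [t]) serves both. *)
have [t /andP[t1 t2]|s /andP[s1 s2] Es] := mvt (f := fun x => A x y1 - A x (y1 + l))
    (f' := fun x => P x y1 - P x (y1 + l)) xk.
  by apply: is_deriveB; apply: dA; rewrite ?(lt_le_trans _ t1)// (lt_trans y1b).
have [t /andP[t1 t2]|t /andP[t1 t2] Et] := mvt (f := fun y => B (x1 + k) y - B x1 y)
    (f' := fun y => Q (x1 + k) y - Q x1 y) yl.
  by apply: is_deriveB; apply: dB; rewrite ?(lt_le_trans _ t1)// (lt_trans x1b).
have -> : circ x1 (x1 + k) y1 (y1 + l) =
    (P s y1 - P s (y1 + l)) * k + (Q (x1 + k) t - Q x1 t) * l.
  transitivity ((P s y1 - P s (y1 + l)) * (x1 + k - x1) +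
    (Q (x1 + k) t - Q x1 t) * (y1 + l - y1)).
    by rewrite -Es -Et /circ; ring.
  by congr (_ * _ + _ * _); ring.
have near u (v w : R) : v <= u <= v + w -> forall u', v <= u' <= v + w ->
    `|u' - u| <= w.
  move=> /andP[? ?] u' /andP[? ?]; rewrite ler_norml; apply/andP; split; lra.
have nx u : x1 <= u <= x1 + k -> `|u - x0| <= k.
  by apply: near; rewrite x01.
have ny u : y1 <= u <= y1 + l -> `|u - y0| <= l.
  by apply: near; rewrite y01.
have bP u v : x1 <= u <= x1 + k -> y1 <= v <= y1 + l ->
    `|P u v - P x0 y0 - (a * (u - x0) + b * (v - y0))| <= e / 2 * (k + l).
  move=> hu hv; rewrite (le_trans (H1 u v _ _)) ?ler_wpM2l ?(ltW e2) ?lerD//;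
    rewrite ?(le_lt_trans (nx _ _))// ?nx// ?(le_lt_trans (ny _ _))// ?ny//.
have bQ u v : x1 <= u <= x1 + k -> y1 <= v <= y1 + l ->
    `|Q u v - Q x0 y0 - (b * (u - x0) + c * (v - y0))| <= e / 2 * (k + l).
  move=> hu hv; rewrite (le_trans (H2 u v _ _)) ?ler_wpM2l ?(ltW e2) ?lerD//;
    rewrite ?(le_lt_trans (nx _ _))// ?nx// ?(le_lt_trans (ny _ _))// ?ny//.
have Ix : x1 <= x1 <= x1 + k by rewrite lexx ltW.
have Ix' : x1 <= x1 + k <= x1 + k by rewrite lexx ltW.
have Iy : y1 <= y1 <= y1 + l by rewrite lexx ltW.
have Iy' : y1 <= y1 + l <= y1 + l by rewrite lexx ltW.
have Is : x1 <= s <= x1 + k by rewrite (ltW s1) ltW.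
have It : y1 <= t <= y1 + l by rewrite (ltW t1) ltW.
have := bP _ _ Is Iy; have := bP _ _ Is Iy'.
have := bQ _ _ Ix It; have := bQ _ _ Ix' It.
set P1 := (X in `|X| <= _ -> _); set P2 := (X in _ -> `|X| <= _ -> _).
set P3 := (X in _ -> _ -> `|X| <= _ -> _).
set P4 := (X in _ -> _ -> _ -> `|X| <= _ -> _) => E1 E2 E3 E4.
have -> : (P s y1 - P s (y1 + l)) * k + (Q (x1 + k) t - Q x1 t) * l =
    (P4 - P3) * k + (P1 - P2) * l by rewrite /P1 /P2 /P3 /P4; ring.
rewrite (le_trans (ler_normD _ _))// !normrM !(gtr0_norm k0, gtr0_norm l0).
have F1 := ler_wpM2r (ltW k0) (ler_normB P4 P3).
have F2 := ler_wpM2r (ltW l0) (ler_normB P1 P2).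
have F3 := ler_wpM2r (ltW k0) (lerD E4 E3).
have F4 := ler_wpM2r (ltW l0) (lerD E1 E2).
rewrite expr2; nra.
Qed.

(** Bisection: one of four quarters carries at least a quarter of the boundary integral, and the
    nested quarters shrink to a point where the local estimate contradicts this. *)
Lemma goursat_rect x1 y1 k l : xb < x1 -> yb < y1 -> 0 < k -> 0 < l ->
  circ x1 (x1 + k) y1 (y1 + l) = 0.
Proof.
move=> x1b y1b k0 l0; apply/eqP; rewrite -normr_eq0; apply/negPn/negP => nz.
set K := `|_| in nz; have K0 : 0 < K by rewrite lt_def nz normr_ge0.
have h n : 0 < 2 ^+ n :> R by rewrite exprn_gt0.
pose bad n (p : R * R) := [/\ xb < p.1, yb < p.2 &
  K / 4 ^+ n <= `|circ p.1 (p.1 + k / 2 ^+ n) p.2 (p.2 + l / 2 ^+ n)|].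
(* When [p] is not bad, the witness [p] is a mere default; the implication lets [choice] range over
   all pairs. *)
have step n (p : R * R) : exists q : R * R, bad n p ->
   bad n.+1 q /\ [/\ p.1 <= q.1, q.1 + k / 2 ^+ n.+1 <= p.1 + k / 2 ^+ n,
     p.2 <= q.2 & q.2 + l / 2 ^+ n.+1 <= p.2 + l / 2 ^+ n].
  have [[p1 p2 big]|nb] := pselect (bad n p); last by exists p.
  pose k' := k / 2 ^+ n.+1; pose l' := l / 2 ^+ n.+1.
  have k'0 : 0 < k' by rewrite divr_gt0.
  have l'0 : 0 < l' by rewrite divr_gt0.
  have Ek : k / 2 ^+ n = k' + k' by rewrite /k' exprS; field; rewrite gt_eqF.
  have El : l / 2 ^+ n = l' + l' by rewrite /l' exprS; field; rewrite gt_eqF.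
  have EK : K / 4 ^+ n = 4 * (K / 4 ^+ n.+1).
    by rewrite exprS; field; rewrite gt_eqF// exprn_gt0.
  rewrite Ek El EK in big *.
  have sum4 : circ p.1 (p.1 + (k' + k')) p.2 (p.2 + (l' + l')) =
      circ p.1 (p.1 + k') p.2 (p.2 + l') +
      circ (p.1 + k') (p.1 + k' + k') p.2 (p.2 + l') +
      (circ p.1 (p.1 + k') (p.2 + l') (p.2 + l' + l') +
      circ (p.1 + k') (p.1 + k' + k') (p.2 + l') (p.2 + l' + l')).
    by rewrite /circ !addrA; ring.
  have tri : 4 * (K / 4 ^+ n.+1) <= `|circ p.1 (p.1 + k') p.2 (p.2 + l')| +
      `|circ (p.1 + k') (p.1 + k' + k') p.2 (p.2 + l')| +
      (`|circ p.1 (p.1 + k') (p.2 + l') (p.2 + l' + l')| +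
      `|circ (p.1 + k') (p.1 + k' + k') (p.2 + l') (p.2 + l' + l')|).
    rewrite (le_trans big)// sum4 (le_trans (ler_normD _ _))// lerD//; exact: ler_normD.
  have [q1|q1] := leP (K / 4 ^+ n.+1) `|circ p.1 (p.1 + k') p.2 (p.2 + l')|.
    by exists p => _; rewrite -/k' -/l'; split; split => //; lra.
  have [q2|q2] := leP (K / 4 ^+ n.+1)
      `|circ (p.1 + k') (p.1 + k' + k') p.2 (p.2 + l')|.
    by exists (p.1 + k', p.2) => _; rewrite -/k' -/l'/=; split; split => //=; lra.
  have [q3|q3] := leP (K / 4 ^+ n.+1)
      `|circ p.1 (p.1 + k') (p.2 + l') (p.2 + l' + l')|.
    by exists (p.1, p.2 + l') => _; rewrite -/k' -/l'/=; split; split => //=; lra.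
  exists (p.1 + k', p.2 + l') => _; rewrite -/k' -/l'/=; split; split => //=; lra.
have [s Hs] := choice (fun np : nat * (R * R) => step np.1 np.2).
pose u := fix u n := if n is m.+1 then s (m, u m) else (x1, y1).
have ubad n : bad n (u n).
  elim: n => [|n ih]; last exact: (Hs (n, u n) ih).1.
  by split=> //=; rewrite !expr0 !divr1.
have unext n := (Hs (n, u n) (ubad n)).2.
have [x0 Hx0] : exists x, forall n, (u n).1 <= x <= (u n).1 + k / 2 ^+ n.
  by apply: nested_intervals => [|n]; [exact: ltW|have [? ? _ _] := unext n].
have [y0 Hy0] : exists y, forall n, (u n).2 <= y <= (u n).2 + l / 2 ^+ n.
  by apply: nested_intervals => [|n]; [exact: ltW|have [_ _ ? ?] := unext n].
have x0b : xb < x0 by have /andP[+ _] := Hx0 0%N; exact: lt_le_trans.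
have y0b : yb < y0 by have /andP[+ _] := Hy0 0%N; exact: lt_le_trans.
have kl : 0 < (k + l) ^+ 2 by rewrite exprn_gt0// addr_gt0.
(* With this constant the local estimate at stage [n] reads [K / 4^n / 2], half of the lower bound
   in [bad n]. *)
have [|d d0 Hd] := goursat_local x0b y0b (e := K / (2 * (k + l) ^+ 2)).
  by rewrite divr_gt0// mulr_gt0.
have [n kln] := half_pow_small (k + l) d0.
have [un1 un2 big] := ubad n.
have E : (k + l) / 2 ^+ n = k / 2 ^+ n + l / 2 ^+ n by rewrite mulrDl.
have kn : 0 < k / 2 ^+ n by rewrite divr_gt0.
have ln : 0 < l / 2 ^+ n by rewrite divr_gt0.
have := Hd (u n).1 (u n).2 _ _ un1 un2 kn ln; rewrite -E => /(_ _ _ (Hx0 n) (Hy0 n)).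
have Kn : 0 < K / 4 ^+ n by rewrite divr_gt0// exprn_gt0.
have -> : K / (2 * (k + l) ^+ 2) * ((k + l) / 2 ^+ n) ^+ 2 = K / 4 ^+ n / 2.
  rewrite (_ : 4 = 2 ^+ 2); last by rewrite expr2; ring.
  by rewrite -exprM mulnC exprM; field; rewrite !gt_eqF// addr_gt0.
move=> H; have : K / 4 ^+ n <= K / 4 ^+ n / 2 by apply: le_trans big (H _ _); lra.
lra.
Qed.

(** [circ] changes sign when either pair of sides is exchanged. The oriented form is needed because
    the base point of a potential may lie on any side of [(x, y)]. *)
Lemma goursat x1 x2 y1 y2 : xb < x1 -> xb < x2 -> yb < y1 -> yb < y2 ->
  circ x1 x2 y1 y2 = 0.
Proof.
move=> x1b x2b y1b y2b.
have H u1 u2 v1 v2 : xb < u1 -> yb < v1 -> u1 < u2 -> v1 < v2 -> circ u1 u2 v1 v2 = 0.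
  move=> u1b v1b u12 v12; rewrite -(subrKC u1 u2) -(subrKC v1 v2).
  by apply: goursat_rect => //; rewrite subr_gt0.
case: (ltgtP x1 x2) => x12; last by rewrite /circ x12; ring.
- case: (ltgtP y1 y2) => y12; last by rewrite /circ y12; ring.
  + exact: H.
  + by apply/eqP; rewrite -oppr_eq0 -(H x1 x2 y2 y1)// /circ; apply/eqP; ring.
- case: (ltgtP y1 y2) => y12; last by rewrite /circ y12; ring.
  + by apply/eqP; rewrite -oppr_eq0 -(H x2 x1 y1 y2)// /circ; apply/eqP; ring.
  + by rewrite -(H x2 x1 y2 y1)// /circ; ring.
Qed.

Lemma potential_from_primitives : exists U : R -> R -> R,
  forall x y, xb < x -> yb < y ->
    is_derive x 1 (U ^~ y) (P x y) /\ is_derive y 1 (U x) (Q x y).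
Proof.
(* [U] integrates the form up the line [x = x0] and then horizontally to [(x, y)], which makes its
   [x]-derivative immediate. *)
pose x0 := xb + 1; pose y0 := yb + 1.
exists (fun x y => A x y - A x0 y + B x0 y) => x y xbx yby.
have x0b : xb < x0 by rewrite ltrDl.
have y0b : yb < y0 by rewrite ltrDl.
split.
  have := @is_deriveD _ _ _ (A ^~ y) (cst (- A x0 y + B x0 y)) x 1 _ _
    (dA xbx yby) (is_derive_cst _ _ _).
  rewrite addr0; congr is_derive; apply/funext => t; rewrite !fctE /=; ring.
(* For the [y]-derivative, Goursat exchanges the path for the one ending with a vertical segment,
   where only [B x y] depends on [y]. *)
have := @is_deriveD _ _ _ (B x) (cst (A x y0 - A x0 y0 - B x y0 + B x0 y0)) y 1 _ _
  (dB xbx yby) (is_derive_cst _ _ _).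
rewrite addr0 => /is_derive_eps D; apply: eps_is_derive => e /D[d d0 {}D].
exists (Num.min d (y - yb)) => [|t]; first by rewrite lt_min d0 subr_gt0.
rewrite lt_min => /andP[td ty].
have := D t td; rewrite !fctE.
have tb : yb < t by move: ty; rewrite ltr_norml => /andP[? _]; lra.
have := goursat x0b xbx y0b tb; have := goursat x0b xbx y0b yby; rewrite /circ => G1 G2.
by apply: le_trans; rewrite le_eqVlt; apply/orP; left; apply/eqP; congr `|_|; lra.
Qed.

End Goursat.

(** * A minimum principle on the upper half-plane *)

Section MinimumPrinciple.
Variable R : realType.
Implicit Types (x y t a b c d e h l : R) (P Q : R -> R -> R).

Lemma eq_is_derive (f g : R -> R) x l l' :
  f =1 g -> l = l' -> is_derive x 1 f l -> is_derive x 1 g l'.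
Proof. by move=> /funext -> ->. Qed.

Lemma is_derive_shift (f : R -> R) x h l :
  is_derive (x + h) 1 f l -> is_derive x 1 (fun x => f (x + h)) l.
Proof.
move=> /is_derive_eps fl; apply: eps_is_derive => e /fl[d d0 H]; exists d => // t td.
by have := H (t + h); rewrite (_ : t + h - (x + h) = t - x); [apply|ring].
Qed.

(** The comparison terms have degree at most two in each variable, so this one rule serves the first
    and the second derivatives in both directions. *)
Lemma is_derive_sub_quadratic (f : R -> R) x a b c l : is_derive x 1 f l ->
  is_derive x 1 (fun x => f x - (a * x ^+ 2 + b * x + c)) (l - (2 * a * x + b)).
Proof.
move=> /is_derive_eps fl; apply: eps_is_derive => e e0.
have [|d d0 H] := fl (e / 2); first by lra.
have a1 : 0 < 2 * (`|a| + 1) by have := normr_ge0 a; lra.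
exists (Num.min d (e / (2 * (`|a| + 1)))) => [|t]; first by rewrite lt_min d0 divr_gt0.
rewrite lt_min ltr_pdivlMr// => /andP[td te].
have -> : f t - (a * t ^+ 2 + b * t + c) - (f x - (a * x ^+ 2 + b * x + c)) -
   (t - x) * (l - (2 * a * x + b)) = (f t - f x - (t - x) * l) - a * (t - x) ^+ 2.
  by ring.
rewrite (le_trans (ler_normB _ _))// normrM normrX.
have := H t td; have := normr_ge0 (t - x); have := normr_ge0 a.
have : `|a| * `|t - x| ^+ 2 <= e / 2 * `|t - x|.
  rewrite expr2 mulrA ler_wpM2r//; have := normr_ge0 (t - x); lra.
lra.
Qed.

Lemma small_step d : 0 < d -> exists h, [/\ 0 < h, h < d & h < 1].
Proof.
by move=> d0; exists (Num.min (d / 2) (1 / 2)); case: (ltP (d / 2)) => ?; split; lra.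
Qed.

Lemma ltr_dist_between a b c d : `|b - c| < d ->
  Num.min c b <= a <= Num.max c b -> `|a - c| < d.
Proof.
rewrite !ltr_norml => /andP[? ?].
by case: (leP c b) => ? /andP[? ?]; apply/andP; split; lra.
Qed.

Lemma ltr_dist_above a b c : `|a - b| < b - c -> c < a.
Proof. by rewrite ltr_norml => /andP[? _]; lra. Qed.

(** The primitives start at [x = xb] and [y = yb] and need continuity slightly beyond; hence
    [yb > 0], while the form is closed on [y > 0]. *)
Lemma potential P Q (xb yb : R) : 0 < yb ->
  (forall x y, 0 < y -> exists a b c, has_grad P x y a b /\ has_grad Q x y b c) ->
  exists U : R -> R -> R, forall x y, xb < x -> yb < y ->
    is_derive x 1 (U ^~ y) (P x y) /\ is_derive y 1 (U x) (Q x y).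
Proof.
move=> yb0 cl.
have contP x y : 0 < y -> {for x, continuous (P ^~ y)}.
  move=> /(cl x)[a [b [c [/has_grad_x dP _]]]].
  by apply: differentiable_continuous; apply/derivable1_diffP; exact: ex_derive.
have contQ x y : 0 < y -> {for y, continuous (Q x)}.
  move=> /(cl x)[a [b [c [_ /has_grad_y dQ]]]].
  by apply: differentiable_continuous; apply/derivable1_diffP; exact: ex_derive.
have exA y : exists F : R -> R, yb < y -> forall x, xb < x -> is_derive x 1 F (P x y).
  have [yby|yby] := ltP yb y; last by exists (cst 0).
  have [|t _|F dF] := @primitive R (P ^~ y) (xb - 1) xb; first by lra.
    by apply: contP; exact: lt_trans yby.
  by exists F.
have exB x : exists F : R -> R, forall y, yb < y -> is_derive y 1 F (Q x y).
  have [|t t0|F dF] := @primitive R (Q x) 0 yb => //; first exact: contQ.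
  by exists F.
have [A dA] := choice exA; have [B dB] := choice exB.
apply: (@potential_from_primitives R P Q (fun x y => A y x) B xb yb _ (fun x y _ => dB x y)).
  by move=> x y xbx yby; exact: dA.
by move=> x y _ yby; apply: cl; exact: lt_trans yby.
Qed.

(** Partial derivatives alone do not give joint continuity. Here [P] and [Q] are locally bounded
    because they are differentiable, and the mean value theorem is applied along two sides of a
    rectangle. *)
Lemma potential_continuous P Q (U : R -> R -> R) (xb yb : R) x y :
  (forall x y, xb < x -> yb < y ->
    is_derive x 1 (U ^~ y) (P x y) /\ is_derive y 1 (U x) (Q x y)) ->
  xb < x -> yb < y ->
  (exists a b, has_grad P x y a b) -> (exists a b, has_grad Q x y a b) ->
  forall e, 0 < e -> exists2 d, 0 < d & forall s t, `|s - x| < d -> `|t - y| < d ->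
    `|U s t - U x y| < e.
Proof.
move=> dU xbx yby [a [b /has_grad_bounded[K K0 [d1 d10 PK]]]].
move=> [a' [b' /has_grad_bounded[L L0 [d2 d20 QL]]]] e e0.
have KL : 0 < K + L by rewrite addr_gt0.
exists (Num.min (Num.min d1 d2) (Num.min (Num.min (x - xb) (y - yb)) (e / (K + L)))).
  by rewrite !lt_min d10 d20 !subr_gt0 xbx yby divr_gt0.
move=> s t; rewrite !lt_min => /andP[/andP[s1 s2] /andP[/andP[s3 s4] s5]].
move=> /andP[/andP[t1 t2] /andP[/andP[t3 t4] t5]].
have tb : yb < t := ltr_dist_above t4.
have H1 : `|U s t - U x t| <= K * `|s - x|.
  apply: (@mvt_bound _ (U ^~ t) (P ^~ t)) => u /ltr_dist_between xu.
    by apply: (dU u t _ tb).1; apply: ltr_dist_above (xu _ s3).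
  by apply: PK => //; exact: xu.
have H2 : `|U x t - U x y| <= L * `|t - y|.
  apply: (@mvt_bound _ (U x) (Q x)) => u /ltr_dist_between yu.
    by apply: (dU x u xbx _).2; apply: ltr_dist_above (yu _ t4).
  by apply: QL; rewrite ?subrr ?normr0//; exact: yu.
have := ler_normD (U s t - U x t) (U x t - U x y); rewrite addrA subrK.
move: s5 t5; rewrite !ltr_pdivlMr//.
have := normr_ge0 (s - x); have := normr_ge0 (t - y); nra.
Qed.

Variables u v : R -> R -> R.
Hypothesis cauchy_riemann : forall x y, 0 < y ->
  exists a b, has_grad u x y a (- b) /\ has_grad v x y b a.

(** [u dx - v dy] is the real part of [f dz], closed by the Cauchy-Riemann equations, so [U] is the
    real part of a primitive of [f = u + i v]. *)
Lemma cauchy_riemann_potential (xb yb : R) : 0 < yb -> exists U : R -> R -> R,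
  [/\ forall x y, xb < x -> yb < y -> is_derive x 1 (U ^~ y) (u x y),
      forall x y, xb < x -> yb < y -> is_derive y 1 (U x) (- v x y) &
      forall x y, xb < x -> yb < y -> forall e, 0 < e -> exists2 d, 0 < d &
        forall s t, `|s - x| < d -> `|t - y| < d -> `|U s t - U x y| < e].
Proof.
move=> yb0; have [|U dU] := @potential u (fun x y => - v x y) xb yb yb0.
  move=> x y /(cauchy_riemann x)[a [b [gu gv]]].
  by exists a, (- b), (- a); split=> //; exact: has_gradN.
exists U; split.
- by move=> x y xbx yby; have [] := dU x y xbx yby.
- by move=> x y xbx yby; have [] := dU x y xbx yby.
move=> x y xbx yby; have [a [b [gu gv]]] := cauchy_riemann x (lt_trans yb0 yby).
apply: (potential_continuous dU) => //; first by exists a, (- b).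
by exists (- b), (- a); exact: has_gradN.
Qed.

(* With [f = u + i v] and [U] as above, the averages [(U (x + h) y - U x y) / h] of [u]
   over horizontal segments are twice differentiable and harmonic, which is not known
   of [u] itself: the continuity of [f'] is not assumed. The minimum principle is
   applied to them, compared with the linear function [m * (y - k)]. *)
Lemma halfplane_lower_bound c L : 0 <= c -> 0 < L ->
  (forall x y, 0 < y -> 0 <= u x y) ->
  (forall x y, 0 < y -> L <= `|x| \/ L <= y -> c <= u x y) ->
  forall x y, 0 < y < L -> `|x| < L -> c * y / (2 * L) <= u x y.
Proof.
move=> c0 L0 u0 uc x1 y1 /andP[y10 y1L] x1L.
(* The comparison function [m * (y - k)] vanishes at [y = k], is below [c] at [y = L], and equals
   [c * y1 / (2 * L)] at [y1]. The extra 1 in [X] keeps segments of length [h < 1] that start at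
   [x = - X] in the region [|x| >= L]. *)
pose k := y1 / 2; pose X := L + 1; pose m := c / L.
have k0 : 0 < k by rewrite divr_gt0.
have m0 : 0 <= m by rewrite divr_ge0// ltW.
have mL : m * L = c by rewrite /m mulfVK// gt_eqF.
have ky1 : y1 = 2 * k by rewrite /k; field.
have XL : X = L + 1 by [].
clearbody k X m; have X0 : 0 < X by lra.
have [U [Ux Uy Uc]] := @cauchy_riemann_potential (- X - 1) (k / 2) (divr_gt0 k0 (ltr0Sn _ 1)).
have k2 : k / 2 < k by lra.
pose rect := `[- X, X] `*` `[k, L] : set (R * R).
have crect : compact rect by apply: compact_setX; exact: segment_compact.
have x1X : - L < x1 < L by rewrite -ltr_norml.
have rect0 : rect !=set0.
  by exists (x1, y1); split => /=; rewrite in_itv/=; apply/andP; split;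
    clear -x1X XL ky1 y10 y1L; lra.
(* The bound is proved for the averages of [u] over segments of length [h]; the derivative of [U] in
   [x] then recovers [u] as [h] tends to 0. *)
suff key h : 0 < h < 1 -> h * (m * (y1 - k)) <= U (x1 + h) y1 - U x1 y1.
  have -> : c * y1 / (2 * L) = m * (y1 - k) by rewrite -mL ky1; field; rewrite gt_eqF.
  apply/ler_addgt0Pl => e e0.
  have x1b : - X - 1 < x1 by lra.
  have y1b : k / 2 < y1 by lra.
  have [d d0 Hd] := is_derive_eps (Ux x1 y1 x1b y1b) e0.
  have [h [h0 hd h1]] := small_step d0.
  have := Hd (x1 + h); rewrite addrAC subrr add0r gtr0_norm// => /(_ hd).
  move=> /(le_trans (ler_norm _)) /= Hh.
  have := key h; rewrite h0 h1 => /(_ isT) kh.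
  have : h * (m * (y1 - k)) <= h * (e + u x1 y1) by lra.
  by rewrite ler_pM2l.
move=> /andP[h0 h1]; apply/ler_addgt0Pl => e e0.
(* Subtracting [e' x^2] makes the Laplacian strictly negative, at a cost of at most [e] on the
   rectangle. *)
pose e' := e / X ^+ 2.
have e'0 : 0 < e' by rewrite divr_gt0// exprn_gt0.
have e'X : e' * X ^+ 2 = e by rewrite mulfVK// gt_eqF// exprn_gt0.
clearbody e'.
pose Z (p : R * R) := U (p.1 + h) p.2 - U p.1 p.2 - h * (m * (p.2 - k)) - e' * p.1 ^+ 2.
have Zc : {within rect, continuous Z}.
  apply: continuous_in_subspaceT => -[x y] /set_mem[/=].
  rewrite !in_itv/= => /andP[x_ge x_le] /andP[y_ge y_le].
  have Uc0 s : - X - 1 < s -> (fun p : R * R => U p.1 p.2) @ (s, y) --> U s y.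
    move=> sX; apply/cvgrPdist_lt => r r0.
    have [|d d0 Hd] := Uc s y sX _ r r0; first by lra.
    exists (ball s d, ball y d); first by split; exact: nbhsx_ballx.
    move=> [s' y'] [/=]; rewrite -!ball_normE/= => sd yd.
    by rewrite distrC Hd// distrC.
  have cf1 : {for (x, y), continuous (fun p : R * R => p.1)} by exact: cvg_fst.
  have cf2 : {for (x, y), continuous (fun p : R * R => p.2)} by exact: cvg_snd.
  apply: cvgB; last by apply: cvgMr; rewrite expr2; apply: cvgM.
  apply: cvgB; last by do 2 apply: cvgMr; apply: cvgB => //; exact: cvg_cst.
  apply: cvgB; last by apply: Uc0; lra.
  apply: (@cvg_comp _ _ _ (fun p : R * R => (p.1 + h, p.2)) (fun p : R * R => U p.1 p.2) _
    (nbhs ((x + h, y) : R * R))); last by apply: Uc0; lra.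
  have cfh : (p.1 + h) @[p --> ((x, y) : R * R)] --> nbhs (x + h).
    by apply: cvgD => //; exact: cvg_cst.
  exact: (cvg_pair cfh cf2).
have [[xm ym] /set_mem[/=]] := compact_EVT_min rect0 crect Zc.
rewrite !in_itv/= => /andP[x_ge x_le] /andP[y_ge y_le] Zmin.
have {}Zmin x y : - X <= x <= X -> k <= y <= L -> Z (xm, ym) <= Z (x, y).
  by move=> xX yL; apply: Zmin; rewrite inE; split; rewrite /= in_itv/=.
suff Zm : - e <= Z (xm, ym).
  have : - e <= Z (x1, y1).
    by apply: le_trans Zm (Zmin _ _ _ _); apply/andP; split;
      clear -x1X XL ky1 y10 y1L; lra.
  rewrite /Z/=; have : 0 <= e' * x1 ^+ 2 by rewrite mulr_ge0 ?sqr_ge0// ltW.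
  lra.
have Xb : - X - 1 < xm by clear -x_ge; lra.
have Xbh : - X - 1 < xm + h by rewrite ltr_wpDr// ltW.
have Yb : k / 2 < ym by exact: lt_le_trans y_ge.
suff : h * (m * (ym - k)) <= U (xm + h) ym - U xm ym \/
    [/\ - X < xm, xm < X, k < ym & ym < L].
  have exm : e' * xm ^+ 2 <= e.
    rewrite -[leRHS]e'X ler_pM2l//.
    rewrite -(real_normK (num_real xm)) ler_pXn2r ?nnegrE ?normr_ge0 ?(ltW X0)//.
    by rewrite ler_norml x_ge.
  case=> [?|[x_gt x_lt y_gt y_lt]]; first by rewrite /Z/=; lra.
  exfalso.
  have ym0 : 0 < ym by exact: lt_le_trans y_ge.
  have [a [b [gu gv]]] := cauchy_riemann xm ym0.
  have [a' [b' [gu' gv']]] := cauchy_riemann (xm + h) ym0.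
  (* At an interior minimum both second derivatives are nonnegative, but by Cauchy-Riemann they add
     up to [- 2 * e']. *)
  have dxx : 0 <= a' - a - 2 * e'.
    apply: (@second_derivative_at_min _ (fun x => Z (x, ym))
      (fun x => u (x + h) ym - u x ym - 2 * e' * x) (- X) X xm).
    - by rewrite x_gt.
    - move=> t /andP[tX Xt].
      have tb : - X - 1 < t by clear -tX; lra.
      have tbh : - X - 1 < t + h by rewrite ltr_wpDr// ltW.
      have := is_derive_sub_quadratic e' 0 (h * (m * (ym - k)))
        (is_deriveB (is_derive_shift (f := U ^~ ym) (Ux _ _ tbh Yb)) (Ux _ _ tb Yb)).
      by apply: eq_is_derive; [move=> r; rewrite /Z/= !fctE; ring|ring].
    - have := is_derive_sub_quadratic 0 (2 * e') 0
        (is_deriveB (is_derive_shift (f := u ^~ ym) (has_grad_x gu')) (has_grad_x gu)).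
      by apply: eq_is_derive; [move=> r; rewrite !fctE; ring|ring].
    - by move=> t /andP[/ltW tX /ltW Xt]; apply: Zmin; apply/andP; split.
  have dyy : 0 <= - a' + a.
    apply: (@second_derivative_at_min _ (fun y => Z (xm, y))
      (fun y => - v (xm + h) y + v xm y - h * m) k L ym).
    - by rewrite y_gt.
    - move=> t /andP[tk tL].
      have tb : k / 2 < t by exact: lt_trans tk.
      have := is_derive_sub_quadratic 0 (h * m) (- (h * (m * k)) + e' * xm ^+ 2)
        (is_deriveB (Uy _ _ Xbh tb) (Uy _ _ Xb tb)).
      by apply: eq_is_derive; [move=> r; rewrite /Z/= !fctE; ring|ring].
    - have := is_derive_sub_quadratic 0 0 (h * m)
        (is_deriveB (has_grad_y gv) (has_grad_y gv')).
      by apply: eq_is_derive; [move=> r; rewrite !fctE; ring|ring].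
    - by move=> t /andP[/ltW tX /ltW Xt]; apply: Zmin; apply/andP; split.
  lra.
(* The average is a value [u t ym] with [xm < t < xm + h]. On the left, right and top sides [c <= u]
   applies; on the bottom [m * (ym - k)] is not positive and [0 <= u] suffices. *)
have [|t|t /andP[t1 t2] E] := @mvt _ (U ^~ ym) (u ^~ ym) xm (xm + h).
- by rewrite ltrDl.
- by move=> /andP[xt _]; apply: Ux => //; exact: lt_le_trans xt.
have ym0 : 0 < ym by exact: lt_le_trans y_ge.
rewrite E (_ : xm + h - xm = h); last by ring.
have p_le_c : m * (ym - k) <= c.
  by rewrite -mL ler_wpM2l//; clear -y_le k0; lra.
have le_case : m * (ym - k) <= u t ym -> h * (m * (ym - k)) <= u t ym * h.
  by move=> ?; rewrite [leRHS]mulrC ler_pM2l.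
have [xX|xX] := ltP (- X) xm; last first.
  left; apply: le_case; apply: le_trans p_le_c _; apply: uc => //; left.
  by rewrite ler_normr; apply/orP; right; clear -xX t2 h1 XL; lra.
have [Xx|Xx] := ltP xm X; last first.
  left; apply: le_case; apply: le_trans p_le_c _; apply: uc => //; left.
  by rewrite ler_normr; apply/orP; left; clear -Xx t1 h0 XL; lra.
have [ky|ky] := ltP k ym; last first.
  left; apply: le_case; apply: le_trans (u0 _ _ ym0).
  by rewrite mulr_ge0_le0// subr_le0.
have [yL|yL] := ltP ym L; last first.
  by left; apply: le_case; apply: le_trans p_le_c _; apply: uc => //; right.
by right.
Qed.

End MinimumPrinciple.

(** * The direct transform *)

(* [ring] does not apply to modules: compare inner products with an arbitrary vector. *)
Ltac vec_ring dot_norm := apply: (dot_inj dot_norm) => ?; rewrite !dotE; ring.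

Section CayleyRelation.
Variables (R : realType) (M : completeNormedModType R[i]).
Variable dot : {dot M for (@Num.conj R[i])}.
Hypothesis dot_norm : forall f : M, `|f| ^+ 2 = dot f f.

Implicit Types (f g h k : M) (a b z mu : R[i]) (T : M -> M) (e : R).

(* With [s = 1] and [s = -1] these are the relations in ( * ) and ( ** ). *)
Definition cayley_rel (s : R[i]) T : set (M * M) :=
  [set (h - s *: T h, s *: h + T h) | h in setT].

Lemma Q_transformE (Om : R[i] -> M -> M) z :
  Q_transform Om z = cayley_rel 1 (Om (mobius z)).
Proof.
apply/seteqP; split=> [_ [_ [[h1 h2] /= H <-] <-]|_ [h _ <-]] /=.
  exists h2 => //; rewrite [h1]H !scale1r; congr (_, _); vec_ring dot_norm.
exists (h - Om (mobius z) h, 2 *: h) => /=.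
  by exists (h - Om (mobius z) h, h).
rewrite !scale1r; congr (_, _); vec_ring dot_norm.
Qed.

Lemma R_transformE (Om : R[i] -> M -> M) z :
  R_transform Om z = cayley_rel (-1) (Om (mobius z)).
Proof.
apply/seteqP; split=> [_ [_ [[h1 h2] /= H <-] <-]|_ [h _ <-]] /=.
  exists h2 => //; rewrite [h1]H; congr (_, _); vec_ring dot_norm.
exists (h + Om (mobius z) h, -2 *: h) => /=.
  by exists (h + Om (mobius z) h, h).
congr (_, _); vec_ring dot_norm.
Qed.

Lemma Q_paramE (Om : R[i] -> M -> M) z :
  Q_param Om z = cayley_rel 1 (Om (mobius z)).
Proof.
by rewrite /Q_param /cayley_rel; congr image; apply/funext => h; rewrite !scale1r.
Qed.

Lemma R_paramE (Om : R[i] -> M -> M) z :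
  R_param Om z = cayley_rel (-1) (Om (mobius z)).
Proof.
rewrite /R_param /cayley_rel; congr image; apply/funext => h.
by congr (_, _); vec_ring dot_norm.
Qed.

Lemma neg_inv_cayley T :
  scale_rel (-1) (inv_rel (cayley_rel 1 T)) = cayley_rel (-1) T.
Proof.
apply/seteqP; split=> [_ [[p1 p2] /= [h _ [<- <-]] <-]|_ [h _ <-]] /=.
  by exists h => //; congr (_, _); vec_ring dot_norm.
exists (1 *: h + T h, h - 1 *: T h); first by exists h.
by congr (_, _); vec_ring dot_norm.
Qed.

Section sign.
Variable s : R[i].
Hypothesis s_sign : s = 1 \/ s = -1.

Lemma sign_sq : s * s = 1.
Proof. by case: s_sign => ->; rewrite ?mulrNN mulr1. Qed.
Lemma sign_conj : s^* = s.
Proof. by case: s_sign => ->; rewrite ?rmorphN rmorph1. Qed.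
Lemma sign_Im : cIm s = 0.
Proof. by case: s_sign => ->; rewrite ?cImN ?oppr0. Qed.
Lemma sign_Re_sq : cRe s * cRe s = 1.
Proof. by have := congr1 cRe sign_sq; rewrite cReM sign_Im mul0r subr0. Qed.

Lemma cayley_linear T : linear T -> linear_relation (cayley_rel s T).
Proof.
move=> lT; split=> [|a _ _ [h _ <-] [k _ <-]].
  by exists 0 => //; rewrite (lin0 lT) !scaler0 subr0 addr0.
by exists (a *: h + k) => //; rewrite lT; congr (_, _); vec_ring dot_norm.
Qed.

(** The source of every sign: the imaginary part is twice that of [(T h, h)], giving dissipativity,
    and the real part has the sign of [s] exactly when [T] does not increase the norm of [h]. *)
Lemma cayley_dot T h : dot (s *: h + T h) (h - s *: T h) =
  s * (nv h ^+ 2 - nv (T h) ^+ 2)%:C%C + (dot (T h) h - (dot (T h) h)^*).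
Proof.
rewrite -(dotC dot h) rmorphB/= -!(dot_sq dot_norm) !dotE sign_conj.
have s2 := sign_sq; ring: s2.
Qed.

Lemma cayley_dot_Im T h :
  cIm (dot (s *: h + T h) (h - s *: T h)) = 2 * cIm (dot (T h) h).
Proof. by rewrite cayley_dot !complexDE sign_Im/=; ring. Qed.

Lemma cayley_dot_Re T h :
  cRe (dot (s *: h + T h) (h - s *: T h)) = cRe s * (nv h ^+ 2 - nv (T h) ^+ 2).
Proof. by rewrite cayley_dot !complexDE sign_Im/=; ring. Qed.

(** From [s^2 = 1] and [mu^2 = -1] comes [s h + T h + mu (h - s T h) = (s + mu) (h - mu T h)]. This
    factorisation is why [mu] is taken to be [i] or [- i]. *)
Lemma cayley_resolvent mu T (B : M -> M) : mu * mu = -1 -> linear T -> linear B ->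
  cancel (fun h => 1 *: h + (- mu) *: T h) B ->
  cancel B (fun h => 1 *: h + (- mu) *: T h) ->
  inv_rel (shift_rel (cayley_rel s T) mu) =
    graph_rel (fun g => (- (s + mu) / 2) *: g + s *: B g).
Proof.
move=> mu2 lT lB BA AB; have s2 := sign_sq.
apply/seteqP; split=> [[p1 p2] [_ [h _ <-] /= [<- <-]] /=|[p1 p2]]; last first.
  rewrite /graph_rel/inv_rel/shift_rel/= => ->.
  (* [(s - mu) / 2] is the inverse of [s + mu], as [(s + mu) (s - mu) = 2]. *)
  pose h := ((s - mu) / 2) *: B p1.
  have Ah : 1 *: h + (- mu) *: T h = ((s - mu) / 2) *: p1.
    rewrite -[in RHS](AB p1) /h (linZ lT); vec_ring dot_norm.
  have Bp : B p1 = (s + mu) *: h.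
    by apply: (dot_inj dot_norm) => k; rewrite !dotE; field: s2 mu2.
  have p1E : p1 = (s + mu) *: (1 *: h + (- mu) *: T h).
    by rewrite Ah; apply: (dot_inj dot_norm) => k; rewrite !dotE; field: s2 mu2.
  exists (h - s *: T h, s *: h + T h); first by exists h.
  congr (_, _) => /=.
    by rewrite Bp p1E; apply: (dot_inj dot_norm) => k; rewrite !dotE; field: s2 mu2.
  by rewrite [RHS]p1E; apply: (dot_inj dot_norm) => k; rewrite !dotE; ring: mu2.
rewrite /graph_rel/=.
have -> : s *: h + T h + mu *: (h - s *: T h) =
      (s + mu) *: (1 *: h + (- mu) *: T h).
  apply: (dot_inj dot_norm) => k; rewrite !dotE; ring: mu2.
rewrite (linZ lB) BA; apply: (dot_inj dot_norm) => k; rewrite !dotE.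
by field: s2 mu2.
Qed.

End sign.
End CayleyRelation.

(** * From [Omega] to the two families *)

Section DirectTransform.
Variables (R : realType) (M : completeNormedModType R[i]).
Variable dot : {dot M for (@Num.conj R[i])}.
Hypothesis dot_norm : forall f : M, `|f| ^+ 2 = dot f f.

Implicit Types (f g h k : M) (a b z mu : R[i]) (T : M -> M) (e : R) (H : set (M * M)).

Lemma dot_injr f g : (forall k, dot k f = dot k g) -> f = g.
Proof. by move=> fg; apply: (dot_inj dot_norm) => k; rewrite dotC fg -dotC. Qed.

Lemma cayley_adjoint (s : R[i]) T T' : s = 1 \/ s = -1 -> linear T' ->
  (forall f g, dot (T f) g = dot f (T' g)) ->
  adjoint_rel dot (cayley_rel s T) = cayley_rel s T'.
Proof.
move=> hs lT' TT'; have s2 := sign_sq hs.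
apply/seteqP; split=> [[k1 k2] adj|_ [k _ <-] _ [h _ <-]] /=; last first.
  by rewrite !dotE !TT' (sign_conj hs); ring: s2.
have E : s *: k1 + T' k1 = k2 - s *: T' k2.
  apply: dot_injr => h; have := adj _ (ex_intro2 _ _ h I erefl) => /=.
  rewrite !dotE !TT' (sign_conj hs) => {}adj; rewrite adj; ring.
have E' : T' k1 = k2 - s *: T' k2 - s *: k1 by rewrite -E addrAC subrr add0r.
(* The parameter is forced: [k1 = k - s T' k] and [k2 = s k + T' k] give [k1 + s k2 = 2 k]. *)
exists (2^-1 *: (k1 + s *: k2)) => //.
rewrite (linZ lT') (linD lT') (linZ lT') E'.
congr (_, _); apply: (dot_inj dot_norm) => k; rewrite !dotE; by field: s2.
Qed.

(** Polarisation with [g = T f]: subtracting the forms at [f + g] and [f - g] gives [4 |g|^2 <= |f +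
    g|^2 + |f - g|^2 = 2 |f|^2 + 2 |g|^2]. *)
Lemma selfadjoint_contraction T : linear T ->
  (forall f, cIm (dot (T f) f) = 0) ->
  (forall f, `|cRe (dot (T f) f)| <= nv f ^+ 2) -> forall f, nv (T f) <= nv f.
Proof.
move=> lT imT reT f.
rewrite -(@ler_pXn2r _ 2) ?nnegrE ?nv_ge0//.
pose g := T f.
(* Symmetry is extracted from the reality of the form at [f + i g]. *)
have sym : cRe (dot (T g) f) = cRe (dot g g).
  have := imT (f + 'i *: g); rewrite (linD lT) (linZ lT) !dotE !complexDE/=.
  have := imT f; have := imT g; rewrite -/g => -> ->; lra.
have sq h : nv h ^+ 2 = cRe (dot h h) by rewrite (Re_dot_sq dot_norm).
have := reT (f + g); have := reT (f - g); rewrite !ler_norml !sq.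
rewrite !(linD lT) (linN lT) -/g !dotE !complexDE sym => /andP[+ _] /andP[_ +].
have := Re_dotC dot f g; lra.
Qed.

Definition half_plane e : set R[i] := [set z | 0 < e * cIm z].

Lemma half1 : half_plane 1 = @upper_half R.
Proof. by apply/seteqP; split=> z; rewrite /half_plane/= mul1r -upper_halfE. Qed.

Lemma halfN1 : half_plane (-1) = @lower_half R.
Proof. by apply/seteqP; split=> z; rewrite /half_plane/= mulN1r oppr_gt0 -lower_halfE. Qed.

Definition signed_dissipative e H :=
  linear_relation H /\ forall p, H p -> 0 <= e * cIm (dot p.2 p.1).

Lemma dissipativeE : dissipative dot = signed_dissipative 1.
Proof.
apply/funext => H; rewrite /dissipative /signed_dissipative; congr and.
by apply: eq_forall => p; rewrite -complexIm ler0c mul1r.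
Qed.

Lemma accumulativeE : accumulative dot = signed_dissipative (-1).
Proof.
apply/funext => H; rewrite /accumulative /signed_dissipative; congr and.
by apply: eq_forall => p; rewrite -complexIm (lecR _ 0) mulN1r oppr_ge0.
Qed.

(** Given [p] in an extension, surjectivity finds [q] in [H] with the same value of [p.2 + mu p.1].
    The difference is [(r, - mu r)], whose form has the wrong sign unless [r = 0]. *)
Lemma signed_dissipative_maximal e mu H : half_plane e mu -> signed_dissipative e H ->
  (forall g, exists2 p, H p & p.2 + mu *: p.1 = g) ->
  maximal_rel (signed_dissipative e) H.
Proof.
move=> emu dH surj; split=> // H' [[_ lH'] dH'] HH'.
apply/seteqP; split=> // -[p1 p2] H'p.
have [[q1 q2] Hq /= qp] := surj (p2 + mu *: p1).
have := lH' (-1) _ _ (HH' _ Hq) H'p => H'r.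
have := dH' _ H'r => /=; rewrite (_ : -1 *: q2 + p2 = - mu *: (-1 *: q1 + p1)); last first.
  apply/eqP; rewrite -subr_eq0; apply/eqP.
  transitivity (p2 + mu *: p1 - (q2 + mu *: q1)); first by vec_ring dot_norm.
  by rewrite qp subrr.
set r := -1 *: q1 + p1; rewrite dotZl (dot_sq dot_norm) !complexDE/=.
rewrite mulr0 add0r mulNr mulrN mulrA oppr_ge0 => le0.
have r0 : r = 0.
  apply/eqP; rewrite -nv_eq0 -sqrf_eq0 eq_le sqr_ge0 andbT.
  by move: le0; rewrite pmulr_rle0.
have p1q1 : p1 = q1 by apply/eqP; rewrite -subr_eq0 addrC -scaleN1r -/r r0.
have p2q2 : p2 = q2 by move: qp; rewrite p1q1 => /addIr.
by rewrite p1q1 p2q2.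
Qed.

Lemma cIm_mobius z : z != 1 -> 0 < normc (1 - z) ^+ 2 /\
  cIm (mobius z) * normc (1 - z) ^+ 2 = 2 * cIm z.
Proof.
move=> z1; have z1' : 1 - z != 0 by rewrite subr_eq0 eq_sym.
split; first by rewrite exprn_gt0// normc_gt0.
rewrite normc_sq; have : mobius z * (1 - z) = 1 + z by rewrite /mobius mulfVK.
move: (mobius z) => [p q]; case: z {z1 z1'} => x y /= [E1 E2].
have -> : q * ((1 - x) ^+ 2 + (0 - y) ^+ 2) =
    (p * (0 - y) + q * (1 - x)) * (1 - x) + (p * (1 - x) - q * (0 - y)) * y by ring.
by rewrite E1 E2; ring.
Qed.

Lemma slit_neq1 z : slit_plane z -> z != 1.
Proof. by apply: contraTneq => ->; rewrite ler01. Qed.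

Lemma mobius_half e z : slit_plane z -> half_plane e z -> half_plane e (mobius z).
Proof.
move=> /slit_neq1/cIm_mobius[n0 E]; rewrite /half_plane/= => ez.
rewrite -(pmulr_lgt0 _ n0) -mulrA E; nra.
Qed.

Lemma mobius_conj z : mobius z^* = (mobius z)^*.
Proof. by rewrite /mobius rmorphM fmorphV rmorphD rmorphB rmorph1. Qed.

Lemma mobius_negative z : negative_axis z -> -1 < mobius z < 1.
Proof.
move=> /negative_axisE[z0 zneg].
have x1 : 0 < 1 - cRe z by rewrite subr_gt0 (lt_trans zneg).
have -> : mobius z = ((1 + cRe z) / (1 - cRe z))%:C%C.
  rewrite rmorphM fmorphV rmorphD rmorphB/= /mobius.
  by have {1 2}-> : z = (cRe z)%:C%C by apply: complex_ext.
rewrite !ltcE/= oppr0 !eqxx/=.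
by rewrite ltr_pdivlMr// ltr_pdivrMr//; apply/andP; split; lra.
Qed.

Lemma RS_domainE z : RS_domain z <-> nonreal z \/ -1 < z < 1.
Proof.
rewrite nonrealE /RS_domain/= !lecE !ltcE/= oppr0 ![0 == cIm z]eq_sym.
have [_|z0] := eqVneq (cIm z) 0; last by split=> // _; left.
by rewrite -!ltNge; split=> [?|[//|]]; [right|].
Qed.

Lemma half_nonreal e z : half_plane e z -> nonreal z.
Proof. by rewrite nonrealE; apply: contraTneq => ->; rewrite mulr0 ltxx. Qed.

Definition half_or_negative e : set R[i] := half_plane e `|` @negative_axis R.

Lemma half_or_negative_slit e z : half_or_negative e z -> slit_plane z.
Proof. by rewrite slit_planeE => -[/half_nonreal|]; [left|right]. Qed.

Lemma mobius_RS_domain z : slit_plane z -> RS_domain (mobius z).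
Proof.
move=> sz; have := sz; rewrite slit_planeE nonreal_half -half1 -halfN1.
rewrite RS_domainE => -[[]|] zE.
- by left; apply: (@half_nonreal 1); exact: mobius_half.
- by left; apply: (@half_nonreal (-1)); exact: mobius_half.
- by right; exact: mobius_negative.
Qed.

Lemma slit_plane_open : open (@slit_plane R : set R[i]^o).
Proof.
have slitE z : slit_plane z <-> cIm z != 0 \/ cRe z < 0.
  rewrite slit_planeE nonrealE negative_axisE.
  by case: eqP => [->|_]; split=> -[]; by [left|right|move=> []; right].
apply/open_complexP => z /slitE[z0|z0].
- exists `|cIm z| => [|w wz]; first by rewrite normr_gt0.
  apply/slitE; left; apply: contraTneq wz => w0.
  by rewrite -leNgt (le_trans _ (Im_le_normc _))// cImD cImN w0 sub0r normrN.
- exists (- cRe z) => [|w wz]; first by rewrite oppr_gt0.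
  apply/slitE; right; have := le_lt_trans (Re_le_normc (w - z)) wz.
  by rewrite cReD cReN ltr_norml => /andP[_]; lra.
Qed.

Lemma RS_Im Om z f : RS dot Om -> cIm z != 0 ->
  0 <= cIm z * cIm (dot (Om z f) f).
Proof.
move=> [_ _ imOm _] z0; have := imOm z (proj2 (nonrealE z) z0) f.
rewrite -!complexIm -fmorphV -rmorphM ler0c => le.
have -> : cIm z * cIm (dot (Om z f) f) =
    cIm (dot (Om z f) f) / cIm z * (cIm z * cIm z) by field.
by rewrite mulr_ge0// -expr2 sqr_ge0.
Qed.

Lemma RS_half Om e z f : RS dot Om -> half_plane e z -> 0 <= e * cIm (dot (Om z f) f).
Proof.
move=> rsOm ez; have := RS_Im f rsOm (proj1 (nonrealE z) (half_nonreal ez)).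
move: ez; rewrite /half_plane/= => ez le.
by rewrite -(pmulr_lge0 _ ez) mulrACA mulr_ge0//  -?expr2 ?sqr_ge0 // mulrC.
Qed.

Lemma RS_real Om z f : RS dot Om -> -1 < z < 1 ->
  cIm (dot (Om z f) f) = 0 /\ `|cRe (dot (Om z f) f)| <= nv f ^+ 2.
Proof.
move=> [_ _ _ reOm] /reOm/(_ f)/andP[]; rewrite (dot_sq dot_norm) !lecE/=.
rewrite oppr0 => /andP[/eqP -> ?] /andP[_ ?]; split=> //.
by rewrite ler_norml; apply/andP.
Qed.

Section transform.
Variables (Om : R[i] -> M -> M) (s : R[i]) (Q : R[i] -> set (M * M)).
Hypotheses (hs : s = 1 \/ s = -1) (rsOm : RS dot Om).
(** Asked only on the slit plane, which is where (b) identifies a given family; the equivalence in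
    (c) relies on this. *)
Hypothesis QE : forall z, slit_plane z -> Q z = cayley_rel s (Om (mobius z)).

Let linOm z : slit_plane z -> linear (Om (mobius z)).
Proof.
by case: rsOm => hol _ _ _ /mobius_RS_domain/hol[/bounded_op_lin].
Qed.

Lemma transform_Im e z f : half_or_negative e z ->
  0 <= e * cIm (dot (Om (mobius z) f) f).
Proof.
move=> ez; have sz := half_or_negative_slit ez.
case: ez => [ez|/mobius_negative zn]; first exact/(RS_half _ rsOm)/mobius_half.
by have [-> _] := RS_real f rsOm zn; rewrite mulr0.
Qed.

Section resolvent.
Variable e : R.
Hypothesis e2 : e * e = 1.
Let mu : R[i] := (0 +i* e)%C.
Let mu2 : mu * mu = -1.
Proof. by apply: complex_ext; rewrite !complexDE/= ?e2; ring. Qed.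

Let A z h := 1 *: h + (- mu) *: Om (mobius z) h.

(** For [mu = e i] the real part of [((1 - mu Omega) g, g)] is [|g|^2 + e Im (Omega g, g)]. *)
Lemma transform_coercive z : half_or_negative e z -> coercive dot 1 (A z).
Proof.
move=> ez g; rewrite /A !dotE !complexDE/= (Re_dot_sq dot_norm).
have := transform_Im g ez; lra.
Qed.

Lemma transform_holomorphic : holomorphic_on (@slit_plane R) A.
Proof.
move=> z sz; case: rsOm => hol _ _ _.
have [bOm hOm] := hol _ (mobius_RS_domain sz); split.
  exact: bounded_op_affine.
apply: (holomorphic_at_affine dot_norm (F := fun z => Om (mobius z))).
have z1 := slit_neq1 sz.
have : scalar_cderiv (@mobius R) z (- (-2) / (z - 1) ^+ 2).
  have := scalar_cderiv_moebius (-1) (-2) z1.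
  (* The radius [|z - 1|] avoids the pole, where the two formulas for [mobius] take different
     default values. *)
  move=> D r /D[d d0 Hd]; exists (Num.min d (normc (z - 1))) => [|w].
    by rewrite lt_min d0 normc_gt0 subr_eq0.
  rewrite lt_min => /andP[/Hd wd wz].
  have w1 : w != 1 by apply: contraTneq wz => ->; rewrite normcB ltxx.
  have mE x : x != 1 -> mobius x = -1 + -2 / (x - 1).
    move=> x1; rewrite /mobius; field.
    by rewrite !subr_eq0 x1 eq_sym x1.
  by rewrite !mE.
by move=> D; apply: (holomorphic_at_comp dot_norm D hOm).
Qed.

(** The whole coercive set of [A] serves as the open domain: it contains the half-plane and the
    negative axis, so no separate continuation argument is needed. *)
Lemma transform_resolvent (E : set R[i]) : E `<=` half_or_negative e ->
  holomorphic_resolvent Q mu E.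
Proof.
move=> Ee.
have [B hB AB] := inverse_holomorphic dot_norm slit_plane_open transform_holomorphic.
exists (coercive_set dot (@slit_plane R) A), (fun z g => (- (s + mu) / 2) *: g + s *: B z g).
have EU : E `<=` coercive_set dot (@slit_plane R) A.
  move=> z /Ee ez; split; first exact: half_or_negative_slit ez.
  by exists 1 => //; exact: transform_coercive.
split=> //.
- exact: coercive_set_open slit_plane_open transform_holomorphic.
- move=> z /hB[bB hBz]; split; first exact: bounded_op_affine.
  exact: (holomorphic_at_affine dot_norm).
move=> z Ez; have sz := half_or_negative_slit (Ee _ Ez).
have [AB1 AB2] := AB z (EU z Ez); have [bB _] := hB z (EU z Ez).
rewrite QE//; apply: cayley_resolvent => //; first exact: linOm.
exact: bounded_op_lin bB.
Qed.

Lemma transform_maximal z : half_plane e z -> maximal_rel (signed_dissipative e) (Q z).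
Proof.
move=> ez; have ez' : half_or_negative e z by left.
have sz := half_or_negative_slit ez'.
apply: (@signed_dissipative_maximal _ mu); first by rewrite /half_plane/= e2 ltr01.
- split; first by rewrite QE//; apply: cayley_linear => //; exact: linOm.
  move=> p; rewrite QE// => -[h _ <-] /=.
  by rewrite cayley_dot_Im// mulrCA mulr_ge0// transform_Im.
move=> g; have [U [F [_ _ _ FE]]] := transform_resolvent (@subset_refl _ _).
have : graph_rel (F z) (g, F z g) by [].
rewrite -FE// => -[[p1 p2] Qp /= [E1 E2]].
by exists (p1, p2).
Qed.

End resolvent.

Lemma transform_adjoint z : nonreal z -> adjoint_rel dot (Q z) = Q z^*.
Proof.
move=> nz; have sz : slit_plane z by rewrite slit_planeE; left.
have sz' : slit_plane z^*.
  by rewrite slit_planeE; left; rewrite nonrealE cIm_conj oppr_eq0 -nonrealE.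
rewrite !QE//; apply: cayley_adjoint => //; first exact: linOm.
move=> f g; case: rsOm => _ adj _ _; rewrite mobius_conj; apply: adj.
have := nz; rewrite nonreal_half -half1 -halfN1 => -[] /(mobius_half sz)/half_nonreal//.
Qed.

Lemma transform_negative z : negative_axis z -> nonneg_rel dot (scale_rel s (Q z)).
Proof.
move=> nz; have sz : slit_plane z by rewrite slit_planeE; right.
have lT := linOm sz; rewrite QE//.
have lQ := cayley_linear dot_norm s lT.
split.
  split; first by exists 0; [exact: lQ.1|rewrite /= scaler0].
  move=> a _ _ [p Qp <-] [q Qq <-]; exists (a *: p + q); first by apply: lQ.2.
  rewrite /= scalerDr scalerA mulrC -scalerA.
  by [].
move=> _ [_ [h _ <-] <-] /=.
have sr f := RS_real f rsOm (mobius_negative nz).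
have := selfadjoint_contraction lT (fun f => (sr f).1) (fun f => (sr f).2) h.
move=> le; rewrite dotZl ge0_complexE !complexDE cayley_dot_Im// cayley_dot_Re//.
rewrite (sr h).1 (sign_Im hs) !mulr0 !mul0r addr0 eqxx subr0 mulrA.
rewrite (sign_Re_sq hs) mul1r subr_ge0 ler_pXn2r ?nnegrE ?nv_ge0//.
Qed.

Definition signed_stieltjes := [/\ nevanlinna_family dot Q,
  forall x, negative_axis x -> nonneg_rel dot (scale_rel s (Q x)) &
  continues_to_negative_axis Q].

Theorem transform_signed_stieltjes : signed_stieltjes.
Proof.
have e1 : 1 * 1 = 1 :> R by rewrite mulr1.
have eN1 : -1 * -1 = 1 :> R by rewrite mulrNN mulr1.
have up : @upper_half R (0 +i* 1)%C by rewrite upper_halfE.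
have low : @lower_half R (0 +i* -1)%C by rewrite lower_halfE/= oppr_lt0.
split; [split| |].
- split=> z; rewrite -?half1 -?halfN1 ?dissipativeE ?accumulativeE;
    exact: transform_maximal.
- exact: transform_adjoint.
- exists (0 +i* 1)%C => //; apply: transform_resolvent => //.
  by rewrite -half1; exact: subsetUl.
- exists (0 +i* -1)%C => //; apply: transform_resolvent => //.
  by rewrite -halfN1; exact: subsetUl.
- exact: transform_negative.
split.
- exists (0 +i* 1)%C => //; apply: transform_resolvent => //.
  by rewrite -half1.
- exists (0 +i* -1)%C => //; apply: transform_resolvent => //.
  by rewrite -halfN1.
Qed.

End transform.
End DirectTransform.

(** * The converse *)

Section InverseTransform.
Variables (R : realType) (M : completeNormedModType R[i]).
Variable dot : {dot M for (@Num.conj R[i])}.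
Hypothesis dot_norm : forall f : M, `|f| ^+ 2 = dot f f.

Implicit Types (f g h k : M) (a b z mu : R[i]) (T : M -> M) (e : R) (H : set (M * M)).

Lemma resolvent_mem H mu (F : M -> M) :
  inv_rel (shift_rel H mu) = graph_rel F ->
  forall p, H p <-> p.1 = F (p.2 + mu *: p.1).
Proof.
move=> HF [p1 p2] /=; split=> [Hp|E].
  have : inv_rel (shift_rel H mu) (p2 + mu *: p1, p1) by exists (p1, p2).
  by rewrite HF.
have : graph_rel F (p2 + mu *: p1, p1) by [].
by rewrite -HF => -[[q1 q2] Hq /= [E1 E2]]; move: E2 Hq; rewrite E1 => /addIr ->.
Qed.

Lemma cauchy_riemann_of_cderiv (G : R[i] -> M -> M) g x0 y0 :
  holomorphic_at G (x0 +i* y0)%C ->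
  exists a b : R, has_grad (fun x y => cRe (dot (G (x +i* y)%C g) g)) x0 y0 a (- b) /\
    has_grad (fun x y => cIm (dot (G (x +i* y)%C g) g)) x0 y0 b a.
Proof.
move=> /holomorphic_atP[D bD GD].
set z0 := (x0 +i* y0)%C.
exists (cRe (dot (D g) g)), (cIm (dot (D g) g)).
have main (r : R) : 0 < r -> exists2 d : R, 0 < d & forall x y,
    `|x - x0| < d -> `|y - y0| < d ->
    normc (dot (G (x +i* y)%C g - G z0 g - ((x +i* y)%C - z0) *: D g) g) <=
    r * (`|x - x0| + `|y - y0|).
  move=> r0; have n0 : 0 < nv g ^+ 2 + 1 by rewrite ltr_wpDl// sqr_ge0.
  (* Pairing with [g] costs a factor [nv g ^+ 2]; the [+ 1] keeps the denominator positive. *)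
  have [|d d0 Hd] := GD (r / (nv g ^+ 2 + 1)); first by rewrite divr_gt0.
  exists (d / 2) => [|x y xd yd]; first by rewrite divr_gt0.
  rewrite (le_trans (normc_dot_le dot_norm _ _))//.
  have le : normc ((x +i* y)%C - z0) <= `|x - x0| + `|y - y0| := normc_le_ReIm _.
  have := Hd (x +i* y)%C _ g => /(_ (le_lt_trans le _)).
  move=> /(_ ltac:(lra)) H.
  have rN : r / (nv g ^+ 2 + 1) * nv g ^+ 2 <= r.
    by rewrite mulrAC ler_pdivrMr// ler_wpM2l ?(ltW r0)// lerDl.
  rewrite (le_trans (ler_wpM2r (nv_ge0 g) H))//.
  set t := normc _ in le *.
  have -> : r / (nv g ^+ 2 + 1) * t * nv g * nv g =
      r / (nv g ^+ 2 + 1) * nv g ^+ 2 * t by ring.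
  by rewrite (le_trans (ler_wpM2r (normc_ge0 _) rN))// ler_wpM2l// ltW.
split=> r /main[d d0 Hd]; exists d => // x y xd yd; apply: le_trans (Hd x y xd yd).
  apply: le_trans (Re_le_normc _); rewrite !dotE !complexDE/=.
  by rewrite le_eqVlt; apply/orP; left; apply/eqP; congr `|_|; ring.
apply: le_trans (Im_le_normc _); rewrite !dotE !complexDE/=.
by rewrite le_eqVlt; apply/orP; left; apply/eqP; congr `|_|; ring.
Qed.

Section core.
Variables (s : R[i]) (e : R) (mu : R[i]) (Q : R[i] -> set (M * M)).
Variables (U : set R[i]^o) (F : R[i] -> M -> M).
Hypotheses (hs : s = 1 \/ s = -1) (e_sign : e = 1 \/ e = -1) (emu : half_plane e mu).
Hypotheses (Uo : open U) (EU : half_or_negative e `<=` U) (hF : holomorphic_on U F).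
Hypothesis QF : forall z, half_or_negative e z ->
  forall p, Q z p <-> p.1 = F z (p.2 + mu *: p.1).
Hypothesis Qdiss : forall z, half_plane e z -> forall p, Q z p -> 0 <= e * cIm (dot p.2 p.1).
Hypothesis Qneg : forall z, negative_axis z -> forall p, Q z p ->
  0 <= dot (s *: p.2) p.1.

Let e2 : e * e = 1.
Proof. by case: e_sign => ->; rewrite ?mulrNN mulr1. Qed.

Let mu_neq_s : mu - s != 0.
Proof.
by apply: contraTneq emu => /(congr1 cIm); rewrite cImD cImN (sign_Im hs) subr0
  /half_plane/= => ->; rewrite mulr0 ltxx.
Qed.

Let muc_neq_s : mu^* - s != 0.
Proof. by rewrite -(sign_conj hs) -rmorphB fmorph_eq0. Qed.

(* With [nu] the conjugate of [mu], [1 - C] is the Cayley transform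
   [(Q + nu) (Q + mu)^-1], a contraction, times the unimodular scalar
   [(mu - s) / (nu - s)]; and [C] is a multiple of [(Q + s) (Q + mu)^-1]. *)
Let w : R[i] := (mu^* - mu) / (mu^* - s).
Let C z g := w *: g + (w * (s - mu)) *: F z g.

Let w_neq0 : w != 0.
Proof.
rewrite /w mulf_neq0 ?invr_eq0//; apply: contraTneq emu => /(congr1 cIm).
rewrite cImD cImN cIm_conj /half_plane/= => H.
have -> : cIm mu = 0 by lra.
by rewrite mulr0 ltxx.
Qed.

Lemma C_holomorphic : holomorphic_on U C.
Proof.
move=> z /hF[bF hFz]; split; first exact: bounded_op_affine.
exact: (holomorphic_at_affine dot_norm).
Qed.

Let QFz z g : half_or_negative e z -> Q z (F z g, g - mu *: F z g).
Proof. by move=> ez; apply/QF => //=; rewrite subrK. Qed.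

Lemma half_dissipative z p : half_or_negative e z -> Q z p ->
  0 <= e * cIm (dot p.2 p.1).
Proof.
move=> [ez|nz] Qp; first exact: Qdiss ez _ Qp.
have := Qneg nz Qp; rewrite dotZl ge0_complexE cImM (sign_Im hs) mul0r addr0.
rewrite mulf_eq0 => /andP[/orP[/eqP s0|/eqP ->] _]; last by rewrite mulr0.
by have := sign_Re_sq hs; rewrite s0 mulr0 => /eqP; rewrite eq_sym oner_eq0.
Qed.

(** This is [|g - C g|^2 <= |g|^2] expanded. It reduces coercivity to a lower bound on [|C g|]. *)
Lemma C_quadratic z g : half_or_negative e z ->
  nv (C z g) ^+ 2 <= 2 * cRe (dot (C z g) g).
Proof.
move=> ez; set f := F z g; set f' := g - mu *: f.
have diss := half_dissipative ez (QFz g ez); rewrite -/f -/f' /= in diss.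
have gE : g = f' + mu *: f by rewrite /f' subrK.
clearbody f'.
have CE : g - C z g = ((mu - s) / (mu^* - s)) *: (f' + mu^* *: f).
  rewrite /C -/f gE /w; apply: (dot_inj dot_norm) => k; rewrite !dotE.
  by field.
have nC : nv (g - C z g) = nv (f' + mu^* *: f).
  rewrite CE nvZ ComplexField.Normc.normcM ComplexField.Normc.normcV.
  have -> : normc (mu^* - s) = normc (mu - s).
    by rewrite -[RHS]normc_conj rmorphB /= (sign_conj hs).
  by rewrite mulfV ?mul1r// gt_eqF// normc_gt0.
have le : nv (g - C z g) ^+ 2 <= nv g ^+ 2.
  rewrite nC [in leRHS]gE -!(Re_dot_sq dot_norm) !dotE !complexDE/=.
  have := Im_dotC dot f f'; have := Re_dotC dot f f' => -> ->.
  have : 0 <= (e * cIm mu) * (e * cIm (dot f' f)) by rewrite mulr_ge0// ltW.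
  by rewrite mulrACA e2 mul1r; lra.
move: le; move: (C z g) => k.
rewrite -!(Re_dot_sq dot_norm) !dotE !complexDE (Re_dotC dot g k); lra.
Qed.

Lemma C_coercive_negative z : negative_axis z ->
  exists2 c : R, 0 < c & coercive dot c (C z).
Proof.
move=> nz; have ez : half_or_negative e z by right.
pose m := 1 + normc mu ^+ 2; have m0 : 0 < m by rewrite ltr_wpDr// sqr_ge0.
have nw : 0 < normc w ^+ 2 by rewrite exprn_gt0// normc_gt0.
(* One factor 2 comes from [C_quadratic], the other from [|g|^2 <= 2 m (|f'|^2 + |f|^2)]. *)
exists (normc w ^+ 2 / (4 * m)) => [|g]; first by rewrite divr_gt0// mulr_gt0.
set f := F z g; set f' := g - mu *: f.
have gE : g = f' + mu *: f by rewrite /f' subrK.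
have := Qneg nz (QFz g ez); rewrite -/f -/f' /= dotZl ge0_complexE => /andP[_].
rewrite cReM (sign_Im hs) mul0r subr0 => pos.
clearbody f'.
have CE : C z g = w *: (f' + s *: f).
  rewrite /C -/f [in LHS]gE; vec_ring dot_norm.
have nC : normc w ^+ 2 * (nv f' ^+ 2 + nv f ^+ 2) <= nv (C z g) ^+ 2.
  rewrite CE nvZ exprMn ler_pM2l// -!(Re_dot_sq dot_norm) !dotE !complexDE/=.
  rewrite (sign_Im hs) (Re_dotC dot f f').
  have : cRe s * (cRe s * cRe (dot f f)) = cRe (dot f f).
    by rewrite mulrA (sign_Re_sq hs) mul1r.
  lra.
have ng : nv g ^+ 2 <= 2 * m * (nv f' ^+ 2 + nv f ^+ 2).
  have : nv g ^+ 2 <= (nv f' + normc mu * nv f) ^+ 2.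
    rewrite ler_pXn2r ?nnegrE ?nv_ge0 ?addr_ge0 ?mulr_ge0 ?normc_ge0 ?nv_ge0//.
    by rewrite -nvZ [in leLHS]gE nvD.
  rewrite /m; have := sqr_ge0 (nv f' - normc mu * nv f).
  have := sqr_ge0 (normc mu * nv f'); have := sqr_ge0 (nv f); nra.
have := C_quadratic g ez.
have -> : normc w ^+ 2 / (4 * m) * nv g ^+ 2 = normc w ^+ 2 * (nv g ^+ 2 / (4 * m)) by ring.
have : normc w ^+ 2 * (nv g ^+ 2 / (4 * m)) <=
    normc w ^+ 2 * ((nv f' ^+ 2 + nv f ^+ 2) / 2).
  rewrite ler_pM2l// ler_pdivrMr ?mulr_gt0//; lra.
lra.
Qed.

Lemma C_coercive z : half_or_negative e z ->
  exists2 c : R, 0 < c & coercive dot c (C z).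
Proof.
move=> [ez|]; last exact: C_coercive_negative.
have nN1 : @negative_axis R (-1) by rewrite /negative_axis/= oppr_lt0 ltr01.
have [c c0 cN1] := C_coercive_negative nN1.
have [d d0 Hd] := coercive_near dot_norm c0 (proj2 (C_holomorphic (EU (or_intror nN1)))) cN1.
pose E : R[i] := e%:C%C.
have E2 : E * E = 1 by rewrite -rmorphM e2.
have NE : - E = (- e)%:C%C by rewrite rmorphN.
(* [psi] maps the upper half-plane to the half-plane of sign [e] and infinity to -1. *)
pose psi (x : R[i]) : R[i] := -1 + (- E) / (x - 0).
have normE1 : normc (- E) = 1.
  by rewrite NE normc_real normrN; case: e_sign => ->; rewrite ?normrN normr1.
have psi_half (x y : R) : 0 < y -> half_plane e (psi (x +i* y)%C).
  move=> y0; change (0 < e * cIm (psi (x +i* y)%C)).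
  rewrite /psi subr0 NE cImD cIm_div_real/=.
  rewrite oppr0 add0r opprK mulrA e2 mul1r divr_gt0// sqr_sqrtr ?addr_ge0 ?sqr_ge0//.
  by rewrite ltr_wpDl ?sqr_ge0// exprn_gt0.
pose z' := (- E) / (z + 1).
have z1 : z + 1 != 0.
  apply: contraTneq ez => /(congr1 cIm); rewrite cImD /= addr0 /half_plane/= => ->.
  by rewrite mulr0 ltxx.
have psiz : psi z' = z.
  have E0 : - E != 0 by rewrite -normc_gt0 normE1.
  by rewrite /psi /z' subr0 invf_div mulrCA mulfV// mulr1 addrC addrK.
have z'0 : 0 < cIm z'.
  rewrite /z' NE cIm_div_real opprK mulrA cImD /= addr0.
  by rewrite divr_gt0// exprn_gt0// normc_gt0.
(* [L] is large enough for [z'] to satisfy [|x| < L] and [y < L], and for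
   [|psi + 1| = 1 / |x + i y|] to be below [d] outside that box. *)
pose L := `|cRe z'| + cIm z' + d^-1 + 1.
have dV : 0 < d^-1 by rewrite invr_gt0.
have L0 : 0 < L by rewrite /L; have := normr_ge0 (cRe z'); lra.
exists (c / 2 * cIm z' / (2 * L)) => [|g].
  by rewrite !divr_gt0// ?mulr_gt0// divr_gt0.
pose u x y := cRe (dot (C (psi (x +i* y)%C) g) g).
pose v x y := cIm (dot (C (psi (x +i* y)%C) g) g).
have := @halfplane_lower_bound R u v _ (c / 2 * nv g ^+ 2) L _ L0 _ _ (cRe z') (cIm z').
have -> : u (cRe z') (cIm z') = cRe (dot (C z g) g).
  by rewrite /u (_ : (_ +i* _)%C = z') ?psiz//; case: (z').
have -> : c / 2 * cIm z' / (2 * L) * nv g ^+ 2 = c / 2 * nv g ^+ 2 * cIm z' / (2 * L).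
  by ring.
apply.
- move=> x y y0; apply: cauchy_riemann_of_cderiv (fun z => C (psi z)) _ _ _ _.
  have xy0 : (x +i* y)%C != 0 :> R[i].
    by apply: contraTneq y0 => /(congr1 cIm)/= ->; rewrite ltxx.
  apply: (holomorphic_at_comp dot_norm (scalar_cderiv_moebius (-1) (- E) xy0)).
  by apply: (proj2 (C_holomorphic _)); apply: EU; left; exact: psi_half.
- by rewrite mulr_ge0 ?sqr_ge0// ltW// divr_gt0.
- move=> x y y0; have := C_quadratic g (or_introl (psi_half x y y0)).
  by rewrite /u; have := sqr_ge0 (nv (C (psi (x +i* y)%C) g)); lra.
- move=> x y y0 xyL; apply: Hd; rewrite /psi opprK addrAC addNr add0r subr0.
  rewrite ComplexField.Normc.normcM normE1 mul1r ComplexField.Normc.normcV.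
  have : L <= normc (x +i* y)%C.
    by case: xyL => /le_trans; apply; [exact: (Re_le_normc (x +i* y)%C)|
      apply: le_trans (ler_norm _) (Im_le_normc (x +i* y)%C)].
  move=> Lw; rewrite invf_plt ?posrE// ?(lt_le_trans L0)// (lt_le_trans _ Lw)// /L.
  by have := normr_ge0 (cRe z'); lra.
- by rewrite z'0/= /L; have := normr_ge0 (cRe z'); lra.
- by rewrite /L; lra.
Qed.

Lemma shifted_resolvent : exists (V : set R[i]^o) (S : R[i] -> M -> M),
  [/\ open V, half_or_negative e `<=` V, holomorphic_on V S &
    forall z, half_or_negative e z -> forall p, Q z p <-> p.1 = S z (p.2 + s *: p.1)].
Proof.
have [B hB BC] := inverse_holomorphic dot_norm Uo C_holomorphic.
have sm : s - mu != 0 by rewrite -opprB oppr_eq0.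
(* As [C = w (Q + s) (Q + mu)^-1], its inverse satisfies [w B = (Q + mu) (Q + s)^-1 = 1 - (s - mu)
   (Q + s)^-1], which is solved for [(Q + s)^-1]. *)
pose S z g := (s - mu)^-1 *: g + (- w / (s - mu)) *: B z g.
exists (coercive_set dot U C), S.
have EV : half_or_negative e `<=` coercive_set dot U C.
  by move=> z ez; split; [exact: EU|exact: C_coercive].
split=> //; first exact: coercive_set_open Uo C_holomorphic.
  move=> z /hB[bB hBz]; split; first exact: bounded_op_affine.
  exact: (holomorphic_at_affine dot_norm).
move=> z ez [p1 p2] /=; have [CB BC'] := BC z (EV z ez).
have [bB _] := hB z (EV z ez); have lB := bounded_op_lin bB.
rewrite (QF ez) /=; set k := p2 + s *: p1.
have gE : p2 + mu *: p1 = k - (s - mu) *: p1 by rewrite /k; vec_ring dot_norm.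
clearbody k; rewrite gE /S; split=> E.
  have Cg : C z (k - (s - mu) *: p1) = w *: k.
    rewrite /C -E; vec_ring dot_norm.
  have Bk : w *: B z k = k - (s - mu) *: p1 by rewrite -(linZ lB) -Cg CB.
  have -> : (- w / (s - mu)) *: B z k = (- (s - mu)^-1) *: (w *: B z k).
    by rewrite scalerA mulNr mulrC mulNr.
  by rewrite Bk; apply: (dot_inj dot_norm) => l; rewrite !dotE; field.
have Bk : w *: B z k = k - (s - mu) *: p1.
  by rewrite E; apply: (dot_inj dot_norm) => l; rewrite !dotE; field.
have : C z (w *: B z k) = w *: k.
  have [[lC _] _] := C_holomorphic (EU ez); rewrite (linZ lC) BC'//.
rewrite Bk /C; set FF := F z _ => H.
have wsm : w * (s - mu) != 0 by rewrite mulf_neq0.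
apply: (scalerI wsm); apply: (addrI (w *: (k - (s - mu) *: p1))); rewrite H; vec_ring dot_norm.
Qed.

End core.
End InverseTransform.

(** * Gluing the half-planes and recovering [Omega] *)

Section Converse.
Variables (R : realType) (M : completeNormedModType R[i]).
Variable dot : {dot M for (@Num.conj R[i])}.
Hypothesis dot_norm : forall f : M, `|f| ^+ 2 = dot f f.

Implicit Types (f g h k : M) (a b z mu : R[i]) (T : M -> M) (e : R) (H : set (M * M)).

Lemma holomorphic_at_near (F G : R[i] -> M -> M) z0 (d : R) : 0 < d ->
  (forall z, normc (z - z0) < d -> F z = G z) -> holomorphic_at F z0 ->
  holomorphic_at G z0.
Proof.
move=> d0 FG /holomorphic_atP[D bD FD]; apply/holomorphic_atP; exists D => // e.
move=> /FD[d' d'0 H]; exists (Num.min d d') => [|z]; first by rewrite lt_min d0.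
rewrite lt_min => /andP[zd /H]; rewrite FG// FG//.
by rewrite subrr ComplexField.Normc.normc0.
Qed.

(* The derivatives agree because they are computed along the common axis. *)
Lemma holomorphic_at_glue (F G K : R[i] -> M -> M) z0 : negative_axis z0 ->
  (forall z, negative_axis z -> F z = G z) ->
  (forall z, slit_plane z -> K z = F z \/ K z = G z) ->
  holomorphic_at F z0 -> holomorphic_at G z0 -> holomorphic_at K z0.
Proof.
move=> nz0 FG KFG /holomorphic_atP[D bD FD] /holomorphic_atP[D' _ GD].
have sz0 : slit_plane z0 by rewrite slit_planeE; right.
have [_ z0neg] := proj1 (negative_axisE z0) nz0.
have [im0 _] := proj1 (negative_axisE z0) nz0.
have K0F : K z0 = F z0 by case: (KFG _ sz0) => // ->; rewrite FG.
have K0G : K z0 = G z0 by rewrite K0F FG.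
have DD' g : D g = D' g.
  apply/eqP; rewrite -subr_eq0 -nv_eq0 eq_le nv_ge0 andbT.
  apply/ler_addgt0Pl => e e0; rewrite addr0.
  have n0 : 0 < 2 * (nv g + 1) by rewrite mulr_gt0// ltr_wpDl// nv_ge0.
  have e'0 : 0 < e / (2 * (nv g + 1)) by rewrite divr_gt0.
  have [d d0 Hd] := FD _ e'0; have [d' d'0 Hd'] := GD _ e'0.
  pose t := Num.min (d / 2) (d' / 2).
  have t0 : 0 < t by rewrite lt_min !divr_gt0.
  have td : t < d by rewrite /t; case: (ltP (d / 2)) => ?; lra.
  have td' : t < d' by rewrite /t; case: (ltP (d / 2)) => ?; lra.
  have zt : normc (z0 + (- t)%:C%C - z0) = t.
    by rewrite addrAC subrr add0r normc_real normrN gtr0_norm.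
  (* A step to the left stays on the axis whatever its length. *)
  have nz : negative_axis (z0 + (- t)%:C%C).
    by apply/negative_axisE; rewrite cImD cReD /= addr0; split=> //; lra.
  have := Hd _ (eq_ind_r (fun x => x < d) td zt) g.
  have := Hd' _ (eq_ind_r (fun x => x < d') td' zt) g.
  rewrite zt -FG// -FG//; set u := F _ g - F z0 g; set z := _ - z0 => H1 H2.
  have : nv (z *: (D g - D' g)) <= 2 * (e / (2 * (nv g + 1)) * t * nv g).
    have -> : z *: (D g - D' g) = (u - z *: D' g) - (u - z *: D g) by vec_ring dot_norm.
    by rewrite (le_trans (nvD _ _))// nvN; lra.
  rewrite nvZ zt.
  have -> : 2 * (e / (2 * (nv g + 1)) * t * nv g) = t * (e * (nv g / (nv g + 1))).
    by field; rewrite gt_eqF// ltr_wpDl// nv_ge0.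
  rewrite ler_pM2l// => /le_trans; apply.
  rewrite ger_pMr// ler_pdivrMr ?mul1r ?lerDl//.
  by rewrite ltr_wpDl// nv_ge0.
apply/holomorphic_atP; exists D => // e e0.
have [d d0 Hd] := FD _ e0; have [d' d'0 Hd'] := GD _ e0.
have [d'' d''0 Hd''] := proj1 (open_complexP _) (@slit_plane_open R) z0 sz0.
exists (Num.min (Num.min d d') d'') => [|z]; first by rewrite !lt_min d0 d'0.
rewrite !lt_min => /andP[/andP[zd zd'] /Hd''/KFG[] ->] g.
  by rewrite K0F; exact: Hd.
by rewrite K0G DD'; exact: Hd'.
Qed.

(** This is [(z - 1) / (z + 1)], written in the shape [a + b / (z - c)] whose derivative is already
    known. *)
Definition inv_mobius (z : R[i]) : R[i] := 1 + (- 2) / (z - (-1)).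

Lemma inv_mobiusE z : z != -1 -> inv_mobius z = - mobius (- z).
Proof.
rewrite -subr_eq0 opprK => z1; rewrite /inv_mobius /mobius !opprK; field.
by rewrite [1 + z]addrC z1.
Qed.

Lemma inv_mobius_half e z : half_plane e z -> half_plane e (inv_mobius z).
Proof.
move=> ez; have zN1 : z != -1.
  by apply: contraTneq ez => ->; rewrite /half_plane/= oppr0 mulr0 ltxx.
have [|n0 E] := @cIm_mobius R (- z); first by rewrite eqr_oppLR.
rewrite /half_plane/= in ez *; rewrite inv_mobiusE// cImN -(pmulr_lgt0 _ n0).
have -> : e * - cIm (mobius (- z)) * normc (1 - - z) ^+ 2 =
  - e * (cIm (mobius (- z)) * normc (1 - - z) ^+ 2) by ring.
by rewrite E cImN; lra.
Qed.

Lemma inv_mobius_negative z : -1 < z < 1 -> negative_axis (inv_mobius z).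
Proof.
move=> /andP[z0 z1]; have zp : 0 < z + 1 by rewrite -(opprK 1) subr_gt0.
have -> : inv_mobius z = (z - 1) / (z + 1).
  by rewrite /inv_mobius opprK; field; rewrite gt_eqF.
by rewrite /negative_axis/= pmulr_llt0 ?invr_gt0// subr_lt0.
Qed.

Lemma inv_mobius_slit z : RS_domain z -> slit_plane (inv_mobius z).
Proof.
rewrite RS_domainE nonreal_half -half1 -halfN1 slit_planeE => -[[]|].
- by move=> /inv_mobius_half/half_nonreal; left.
- by move=> /inv_mobius_half/half_nonreal; left.
- by move=> /inv_mobius_negative; right.
Qed.

Lemma mobiusK z : slit_plane z -> inv_mobius (mobius z) = z.
Proof.
move=> /slit_neq1 z1; have z1' : 1 - z != 0 by rewrite subr_eq0 eq_sym.
rewrite /inv_mobius /mobius; field.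
by rewrite z1' addrACA subrr addr0 (pnatr_eq0 _ 2).
Qed.

Lemma inv_mobius_conj z : inv_mobius z^* = (inv_mobius z)^*.
Proof. by rewrite /inv_mobius rmorphD rmorphM fmorphV rmorphB !rmorphN rmorph1 rmorph_nat. Qed.

(** The two sides of the premise differ by [2 ((T f, g) - (f, T' g))]. *)
Lemma cayley_adjoint_pair (s : R[i]) T T' f g : s = 1 \/ s = -1 ->
  dot (s *: f + T f) (g - s *: T' g) = dot (f - s *: T f) (s *: g + T' g) ->
  dot (T f) g = dot f (T' g).
Proof.
move=> hs; have s2 := sign_sq hs.
rewrite !dotE (sign_conj hs) => /eqP; rewrite -subr_eq0 => /eqP E.
apply/eqP; rewrite -subr_eq0; apply/eqP.
by rewrite -[RHS](mul0r 2^-1) -E; field: s2.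
Qed.

Lemma cayley_real_bound (s : R[i]) T f : s = 1 \/ s = -1 ->
  0 <= s * dot (s *: f + T f) (f - s *: T f) ->
  - dot f f <= dot (T f) f <= dot f f.
Proof.
move=> hs; rewrite ge0_complexE !complexDE cayley_dot_Im// cayley_dot_Re//.
rewrite (sign_Im hs) !mul0r subr0 addr0 mulrA (sign_Re_sq hs) mul1r.
move=> /andP[/eqP im0 nT].
have {}im0 : cIm (dot (T f) f) = 0.
  have := congr1 (fun x => cRe s * x / 2) im0.
  by rewrite mulrA (sign_Re_sq hs) mulr0 mul0r mul1r => E; lra.
have le : nv (T f) <= nv f.
  by rewrite -(@ler_pXn2r _ 2) ?nnegrE ?nv_ge0// -subr_ge0.
have := Re_dot_le dot_norm (T f) f; have := Re_dot_le dot_norm (- T f) f.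
rewrite dotNl cReN nvN (dot_sq dot_norm) !lecE/= im0 oppr0 eqxx/=.
have := ler_wpM2r (nv_ge0 f) le; rewrite -expr2 => ? ? ?; apply/andP; split; lra.
Qed.

Section sign.
Variables (s : R[i]) (Q : R[i] -> set (M * M)).
Hypotheses (hs : s = 1 \/ s = -1) (hQ : signed_stieltjes dot s Q).

Let Qneg z : negative_axis z -> forall p, Q z p -> 0 <= dot (s *: p.2) p.1.
Proof.
by move=> nz p Qp; case: hQ => _ /(_ z nz)[_ pos] _; apply: (pos (p.1, s *: p.2)); exists p.
Qed.

Let Qdiss e : e = 1 \/ e = -1 -> forall z, half_plane e z ->
  forall p, Q z p -> 0 <= e * cIm (dot p.2 p.1).
Proof.
case: hQ => -[[dis acc] _ _ _] _ _ [->|->] z.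
  by rewrite half1 => /dis[]; rewrite dissipativeE => -[].
by rewrite halfN1 => /acc[]; rewrite accumulativeE => -[].
Qed.

Lemma half_shifted_resolvent e : e = 1 \/ e = -1 ->
  exists (V : set R[i]^o) (S : R[i] -> M -> M),
  [/\ open V, half_or_negative e `<=` V, holomorphic_on V S &
    forall z, half_or_negative e z -> forall p, Q z p <-> p.1 = S z (p.2 + s *: p.1)].
Proof.
move=> he.
have [mu emu [U [F [Uo EU hF QF]]]] : exists2 mu, half_plane e mu &
    holomorphic_resolvent Q mu (half_or_negative e).
  by case: hQ => _ _ [up low]; case: he => ->;
    rewrite /half_or_negative ?half1 ?halfN1.
apply: (shifted_resolvent dot_norm hs he emu Uo EU hF _ (Qdiss he) Qneg).
by move=> z ez; apply: resolvent_mem; exact: QF.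
Qed.

Lemma slit_shifted_resolvent : exists S : R[i] -> M -> M, forall z, slit_plane z ->
  [/\ bounded_op (S z), holomorphic_at S z &
    forall p, Q z p <-> p.1 = S z (p.2 + s *: p.1)].
Proof.
have [V1 [S1 [V1o E1 hS1 QS1]]] := half_shifted_resolvent (or_introl erefl).
have [V2 [S2 [V2o E2 hS2 QS2]]] := half_shifted_resolvent (or_intror erefl).
(* On the axis both resolvents are read off from the same relation [Q z]. *)
have S12 z : negative_axis z -> S1 z = S2 z.
  move=> nz; apply/funext => g.
  have : Q z (S1 z g, g - s *: S1 z g).
    by apply/QS1; [right|rewrite /= subrK].
  by move=> /QS2 /= ->; [rewrite subrK|right].
pose S z := if cIm z < 0 then S2 z else S1 z.
have SE1 z : half_or_negative 1 z -> S z = S1 z.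
  rewrite /S => -[|/negative_axisE[-> _]]; last by rewrite ltxx.
  by rewrite half1 => /upper_halfE z0; rewrite ltNge ltW.
have SE2 z : half_or_negative (-1) z -> S z = S2 z.
  rewrite /S => -[|nz]; first by rewrite halfN1 => /lower_halfE ->.
  by have [-> _] := proj1 (negative_axisE z) nz; rewrite ltxx S12.
exists S => z sz.
have [ez|ez|nz] : [\/ half_plane 1 z, half_plane (-1) z | negative_axis z].
  have := sz; rewrite slit_planeE nonreal_half -half1 -halfN1 => -[[]|] ?;
  by [constructor 1|constructor 2|constructor 3].
- have ez' : half_or_negative 1 z by left.
  have [bS hS] := hS1 z (E1 z ez'); rewrite SE1//; split=> //; last exact: QS1.
  have z0 : 0 < cIm z by move: ez; rewrite half1 => /upper_halfE.
  apply: (holomorphic_at_near (d := cIm z) z0 _ hS) => w wz.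
  rewrite SE1//; left; rewrite half1; apply/upper_halfE.
  have := le_lt_trans (Im_le_normc (w - z)) wz.
  by rewrite cImD cImN ltr_norml => /andP[? _]; lra.
- have ez' : half_or_negative (-1) z by left.
  have [bS hS] := hS2 z (E2 z ez'); rewrite SE2//; split=> //; last exact: QS2.
  have z0 : 0 < - cIm z by rewrite oppr_gt0; move: ez; rewrite halfN1 => /lower_halfE.
  apply: (holomorphic_at_near (d := - cIm z) z0 _ hS) => w wz.
  rewrite SE2//; left; rewrite halfN1; apply/lower_halfE.
  have := le_lt_trans (Im_le_normc (w - z)) wz.
  by rewrite cImD cImN ltr_norml => /andP[_ ?]; lra.
have ez1 : half_or_negative 1 z by right.
have ez2 : half_or_negative (-1) z by right.
have [bS hS] := hS1 z (E1 z ez1); have [_ hS'] := hS2 z (E2 z ez2).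
rewrite SE1//; split=> //; last exact: QS1.
apply: (holomorphic_at_glue nz S12 _ hS hS') => w sw.
by rewrite /S; case: ifP => _; [right|left].
Qed.

Lemma signed_stieltjes_transform : exists2 Om : R[i] -> M -> M, RS dot Om &
  forall z, slit_plane z -> Q z = cayley_rel s (Om (mobius z)).
Proof.
have [S HS] := slit_shifted_resolvent.
pose Om z g := s *: g + (-2) *: S (inv_mobius z) g.
have s2 := sign_sq hs.
have QE z : RS_domain z -> Q (inv_mobius z) = cayley_rel s (Om z).
  move=> dz; have [bS _ QS] := HS _ (inv_mobius_slit dz).
  have lS := bounded_op_lin bS.
  apply/seteqP; split=> [[p1 p2] /QS /= E|_ [h _ <-]].
    (* The parameter comes from [p2 + s p1 = 2 s h] and [s^2 = 1]. *)
    exists ((s / 2) *: (p2 + s *: p1)) => //; rewrite /Om (linZ lS) -E.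
    by congr (_, _); apply: (dot_inj dot_norm) => k; rewrite !dotE; field: s2.
  apply/QS; rewrite /= /Om.
  have -> : s *: h + (s *: h + -2 *: S (inv_mobius z) h) +
     s *: (h - s *: (s *: h + -2 *: S (inv_mobius z) h)) = (2 * s) *: h.
    by apply: (dot_inj dot_norm) => k; rewrite !dotE; ring: s2.
  rewrite (linZ lS).
  by apply: (dot_inj dot_norm) => k; rewrite !dotE; ring: s2.
have QOm z h : RS_domain z ->
    Q (inv_mobius z) (h - s *: Om z h, s *: h + Om z h).
  by move=> dz; rewrite QE//; exists h.
have nonreal_RS z : nonreal z -> RS_domain z by move=> nz; apply/RS_domainE; left.
exists Om; last first.
  by move=> z sz; rewrite -QE ?mobiusK//; exact: mobius_RS_domain.
split.
- move=> z dz; have [bS hS _] := HS _ (inv_mobius_slit dz); split.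
    exact: bounded_op_affine.
  apply: (holomorphic_at_affine dot_norm (F := fun z => S (inv_mobius z))).
  have z1 : z != -1 by apply: contraTneq dz => ->; rewrite /RS_domain/= lexx.
  exact: (holomorphic_at_comp dot_norm (scalar_cderiv_moebius 1 (-2) z1)).
- move=> z nz f g.
  have nz' : nonreal z^* by rewrite nonrealE cIm_conj oppr_eq0 -nonrealE.
  have nw : nonreal (inv_mobius z).
    by move: nz; rewrite nonreal_half -half1 -halfN1 => -[] /inv_mobius_half/half_nonreal.
  have [[_ adj _ _] _ _] := hQ.
  have := QOm _ g (nonreal_RS _ nz'); rewrite inv_mobius_conj -adj//.
  by move=> /(_ _ (QOm _ f (nonreal_RS _ nz)))/(cayley_adjoint_pair hs).
- move=> z nz f; rewrite -!complexIm -fmorphV -rmorphM ler0c.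
  have pos e : e = 1 \/ e = -1 -> half_plane e z -> 0 <= e * cIm (dot (Om z f) f).
    move=> he /inv_mobius_half ez.
    have := Qdiss he ez (QOm z f (nonreal_RS _ nz)); rewrite /= cayley_dot_Im//.
    by rewrite mulrCA pmulr_rge0.
  have := nz; rewrite nonreal_half -half1 -halfN1 => -[] ez.
    have := pos _ (or_introl erefl) ez; rewrite mul1r => ?.
    by rewrite divr_ge0//; move: ez; rewrite half1 => /upper_halfE/ltW.
  have := pos _ (or_intror erefl) ez; rewrite mulN1r oppr_ge0 => ?.
  by rewrite mulr_le0// invr_le0; move: ez; rewrite halfN1 => /lower_halfE/ltW.
move=> z z1 f; have dz : RS_domain z by apply/RS_domainE; right.
have := Qneg (inv_mobius_negative z1) (QOm z f dz); rewrite dotZl /=.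
exact: cayley_real_bound.
Qed.

End sign.
End Converse.

(** * The two classes and the theorem *)

Section Families.
Variables (R : realType) (M : completeNormedModType R[i]).
Variable dot : {dot M for (@Num.conj R[i])}.

Lemma scale_rel1 (H : set (M * M)) : scale_rel 1 H = H.
Proof.
rewrite /scale_rel -[RHS]image_id; congr image.
by apply/funext => -[p1 p2] /=; rewrite scale1r.
Qed.

Lemma stieltjes_signed (Q : R[i] -> set (M * M)) :
  stieltjes_family dot Q <-> signed_stieltjes dot 1 Q.
Proof.
split=> -[nev pos cont]; split=> // x /pos; by rewrite scale_rel1.
Qed.

Lemma inverse_stieltjes_signed (Q : R[i] -> set (M * M)) :
  inverse_stieltjes_family dot Q <-> signed_stieltjes dot (-1) Q.
Proof. by []. Qed.

(** In (c), (b) describes [neg_inv Q] as the negative inverse of a [Q_transform]; injectivity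
    carries the description back to [Q]. *)
Lemma neg_inv_inj (H K : set (M * M)) :
  scale_rel (-1) (inv_rel H) = scale_rel (-1) (inv_rel K) -> H = K.
Proof.
have mem (L : set (M * M)) p : L p <-> scale_rel (-1) (inv_rel L) (p.2, - p.1).
  case: p => p1 p2; split=> [Lp|[[q1 q2] /= Lq [E1 /eqP]]].
    by exists (p2, p1) => //=; rewrite scaleN1r.
  by rewrite scaleN1r eqr_opp -E1 => /eqP <-.
move=> HK; apply/seteqP; split=> p.
  by move=> /(mem H); rewrite HK => /(mem K).
by move=> /(mem K); rewrite -HK => /(mem H).
Qed.

End Families.

Unset Implicit Arguments.

Theorem lemma3p2 (R : realType) (M : completeNormedModType R[i])
    (dot : {dot M for (@Num.conj R[i])}) (hM : separable_hilbert dot) :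
  (* (a) *)
  (forall Om : R[i] -> M -> M, RS dot Om ->
     [/\ forall z, slit_plane z -> Q_transform Om z = Q_param Om z,
         stieltjes_family dot (Q_transform Om),
         forall z, slit_plane z -> R_transform Om z = R_param Om z &
         inverse_stieltjes_family dot (R_transform Om)]) /\
  (* (b) *)
  (forall Q : R[i] -> set (M * M), stieltjes_family dot Q ->
     exists2 Om : R[i] -> M -> M, RS dot Om &
       forall z, slit_plane z ->
         Q z = Q_transform Om z /\ Q z = Q_param Om z) /\
  (forall Q : R[i] -> set (M * M), inverse_stieltjes_family dot Q ->
     exists2 Om : R[i] -> M -> M, RS dot Om &
       forall z, slit_plane z ->
         Q z = R_transform Om z /\ Q z = R_param Om z) /\
  (* (c) *)
  (forall Om : R[i] -> M -> M, RS dot Om ->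
     forall z, slit_plane z ->
       R_transform Om z = neg_inv (Q_transform Om) z) /\
  (forall Q : R[i] -> set (M * M),
     stieltjes_family dot Q <-> inverse_stieltjes_family dot (neg_inv Q)).
Proof.
have dot_norm := hM.1.
have sgn1 : (1 : R[i]) = 1 \/ (1 : R[i]) = -1 by left.
have sgnN1 : (-1 : R[i]) = 1 \/ (-1 : R[i]) = -1 by right.
have negE Om z : R_transform Om z = neg_inv (Q_transform Om) z :> set (M * M).
  by rewrite /neg_inv (Q_transformE dot_norm) (neg_inv_cayley dot_norm)
    (R_transformE dot_norm).
have direct Om : RS dot Om -> stieltjes_family dot (Q_transform Om) /\
    inverse_stieltjes_family dot (R_transform Om).
  move=> rsOm; split; [apply/stieltjes_signed|apply/inverse_stieltjes_signed];
    apply: (transform_signed_stieltjes dot_norm _ rsOm) => // z _.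
    exact: (Q_transformE dot_norm).
  exact: (R_transformE dot_norm).
have converse Q : stieltjes_family dot Q -> exists2 Om : R[i] -> M -> M, RS dot Om &
    forall z, slit_plane z -> Q z = Q_transform Om z.
  move=> /stieltjes_signed/(signed_stieltjes_transform dot_norm sgn1)[Om rsOm QE].
  by exists Om => // z sz; rewrite QE// (Q_transformE dot_norm).
have converse' Q : inverse_stieltjes_family dot Q ->
    exists2 Om : R[i] -> M -> M, RS dot Om &
    forall z, slit_plane z -> Q z = R_transform Om z.
  move=> /inverse_stieltjes_signed/(signed_stieltjes_transform dot_norm sgnN1)[Om rsOm QE].
  by exists Om => // z sz; rewrite QE// (R_transformE dot_norm).
split; [|split; [|split; [|split]]].
- move=> Om rsOm; have [dQ dR] := direct Om rsOm; split=> // z _.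
    by rewrite (Q_transformE dot_norm) Q_paramE.
  by rewrite (R_transformE dot_norm) (R_paramE dot_norm).
- move=> Q /converse[Om rsOm QE]; exists Om => // z sz; rewrite QE//; split=> //.
  by rewrite (Q_transformE dot_norm) Q_paramE.
- move=> Q /converse'[Om rsOm QE]; exists Om => // z sz; rewrite QE//; split=> //.
  by rewrite (R_transformE dot_norm) (R_paramE dot_norm).
- by move=> Om _ z _; exact: negE.
(* Each implication passes through [Omega]: (b) represents one family, and the direct part applies
   to the other with the same function and the opposite sign [s]. *)
move=> Q; split.
  move=> /converse[Om rsOm QE]; apply/inverse_stieltjes_signed.
  apply: (transform_signed_stieltjes dot_norm sgnN1 rsOm) => z sz.
  by rewrite /neg_inv QE// -/(neg_inv _ z) -negE (R_transformE dot_norm).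
move=> /converse'[Om rsOm QE]; apply/stieltjes_signed.
apply: (transform_signed_stieltjes dot_norm sgn1 rsOm) => z sz.
rewrite -(Q_transformE dot_norm); apply: neg_inv_inj.
by have := QE z sz; rewrite negE.
Qed.
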